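(* Let $w\in L^1_{\mathcal M,\Sigma}(\mathbb{R}_{>0})$ be real-valued. Then, up to some dilation of $w$, the following are equivalent: i) $\mathrm{OPE}[n;w]$ is of multiplicative derivative type for all $n\in\mathbb{N}$, $n\ge1$; ii) $\mathrm{OPE}[n;w]=\mathrm{JUE}[n]$ for all $n\in\mathbb{N}$, or $\mathrm{OPE}[n;w]=\mathrm{LUE}[n]$ for all $n\in\mathbb{N}$. Explicitly: i) holds if and only if there is $\lambda>0$ such that, with $\tilde w(x)=w(\lambda x)$, either there are $b>a>-1$ such that for all $n\ge 1$, $\mathrm{OPE}[n;\tilde w]=\mathrm{OPE}[n;\mathcal B^{a,b}]$, or there is $a>-1$ such that for all $n\ge1$, $\mathrm{OPE}[n;\tilde w]=\mathrm{OPE}[n;\mathcal G^a]$.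
   Context: $\Sigma\subset\mathbb{R}_{>0}$ is a (non-degenerate) interval with $\mathbb{Z}_{\ge1}\subset\Sigma$, and $L^1_{\mathcal M,\Sigma}(\mathbb{R}_{>0})=\{f:\mathbb{R}_{>0}\to\mathbb{C}\mid\int_0^\infty|f(x)x^{s-1}|dx<\infty,\ s\in\Sigma\}$; functions equal a.e. are identified. Polynomial ensemble: for $v_1,\dots,v_n:\mathbb{R}\to\mathbb{R}$ with $x^{k-1}v_j(x)\in L^1(\mathbb{R})$ for all $j,k\in\{1,\dots,n\}$, $\mathrm{PE}[v_1,\dots,v_n]$ is the probability density on $\mathbb{R}^n$ given by $\frac1{Z_n}\prod_{1\le j<k\le n}(x_k-x_j)\det[v_j(x_k)]_{j,k=1}^n\ge0$ with normalization constant $Z_n\in\mathbb{R}\setminus\{0\}$ (the notation presupposes that this is a well-defined probability density). Functions on subsets of $\mathbb{R}$ are extended by $0$. The orthogonal polynomial ensemble $\mathrm{OPE}[n;w]$ is $\mathrm{PE}[w,xw,\dots,x^{n-1}w]$. Functions $v_1,\dots,v_n:\mathbb{R}_{>0}\to\mathbb{R}$ are of multiplicative derivative type w.r.t. $\omega\in C^{n-2}(\mathbb{R}_{>0})$ with $\omega^{(n-2)}$ locally absolutely continuous on $\mathbb{R}_{>0}$ (no regularity condition if $n=1$) if $\mathrm{span}\{v_j(x)\}_{j=1}^n=\mathrm{span}\{(x\frac{d}{dx})^{j-1}[\omega(x)]\}_{j=1}^n$ for a.e. $x>0$ (equality of spans of functions, a.e.). A polynomial ensemble $\mathrm{PE}[v_1,\dots,v_n]$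 is of multiplicative derivative type if $v_1,\dots,v_n$ are so with respect to some $\omega$ (which may depend on $n$). For $b>a>-1$, $\mathcal B^{a,b}(x)=x^a(1-x)^{b-a-1}$ on $(0,1)$, and $\mathrm{JUE}[n]$ (Jacobi Unitary Ensemble with parameters $(a,b)$) has eigenvalue density $\mathrm{OPE}[n;\mathcal B^{a,b}]$. For $a>-1$, $\mathcal G^a(x)=x^ae^{-x}$ on $\mathbb{R}_{>0}$, and $\mathrm{LUE}[n]$ (Laguerre Unitary Ensemble with parameter $a$) has eigenvalue density $\mathrm{OPE}[n;\mathcal G^a]$. The parameters do not depend on $n$. *)

(* Defs.v *)
From HB Require Import structures.
From mathcomp Require Import all_boot all_order all_algebra.
From mathcomp Require Import all_classical all_reals all_analysis.

Set Implicit Arguments.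
Unset Strict Implicit.
Unset Printing Implicit Defensive.
Import Order.TTheory GRing.Theory Num.Theory.
Import numFieldNormedType.Exports.

Local Open Scope classical_set_scope.
Local Open Scope ring_scope.

(* Lebesgue measure on R^n, realized on n.-tuple R with its product
   sigma-algebra: the (n+1)-dimensional measure is the image of the product of
   the one- and the n-dimensional ones under (h, t) |-> h :: t. *)
Section lebesgue_tuple.
Context {R : realType}.
Local Notation mR := (measurableTypeR R).
Local Notation mu := (@lebesgue_measure R).

Definition tuple_cons n (p : mR * n.-tuple mR) : n.+1.-tuple mR :=
  [tuple of p.1 :: p.2].

Definition tuple_uncons n (t : n.+1.-tuple mR) : mR * n.-tuple mR :=
  (thead t, [tuple of behead t]).

Lemma tuple_consK n : cancel (@tuple_cons n) (@tuple_uncons n).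
Proof. by move=> [x t]; rewrite /tuple_uncons theadE; congr pair; exact/val_inj. Qed.

Lemma measurable_tuple_cons n : measurable_fun setT (@tuple_cons n).
Proof. by apply: measurable_cons. Qed.

Lemma measurable_tuple_uncons n : measurable_fun setT (@tuple_uncons n).
Proof.
apply/measurable_fun_pairP; split; last exact: measurable_behead.
exact: measurable_tnth.
Qed.

Section cons_measure.
Variables (n : nat) (m : {sigma_finite_measure set (n.-tuple mR) -> \bar R}).

Definition cons_measure : set (n.+1.-tuple mR) -> \bar R :=
  pushforward (mu \x m)%E (@tuple_cons n).

Let cons_measure0 : cons_measure set0 = 0%E.
Proof. by rewrite /cons_measure /pushforward preimage_set0 measure0. Qed.

Let cons_measure_ge0 A : (0 <= cons_measure A)%E.
Proof. by apply: (measure_ge0 (mu \x m)%E). Qed.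

Let cons_measure_sigma_additive : semi_sigma_additive cons_measure.
Proof.
move=> F mF tF mUF; rewrite /cons_measure /pushforward preimage_bigcup.
have mpre A : measurable A -> measurable (@tuple_cons n @^-1` A).
  by move=> mA; rewrite -[X in measurable X]setTI; exact: measurable_tuple_cons.
apply: measure_semi_sigma_additive.
- by move=> k; exact: mpre.
- apply/trivIsetP => /= i j _ _ ij; rewrite -preimage_setI.
  by move/trivIsetP : tF => /(_ _ _ _ _ ij) ->//; rewrite preimage_set0.
- by rewrite -preimage_bigcup; exact: mpre.
Qed.

HB.instance Definition _ := isMeasure.Build _ _ _ cons_measure
  cons_measure0 cons_measure_ge0 cons_measure_sigma_additive.

Lemma cons_measure_sigma_finite : sigma_finite setT cons_measure.
Proof.
have /sigma_finiteP[F [TF ndF Foo]] := sigma_finiteT mu.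
have /sigma_finiteP[G [TG ndG Goo]] := sigma_finiteT m.
exists (fun k => @tuple_uncons n @^-1` (F k `*` G k)).
  rewrite -preimage_bigcup (_ : \bigcup_k _ = setT) ?preimage_setT//.
  apply/seteqP; split=> // -[x y] _.
  have [k _ Fkx] : (\bigcup_k F k) x by rewrite -TF.
  have [l _ Gly] : (\bigcup_k G k) y by rewrite -TG.
  exists (maxn k l) => //; split => /=.
  - by move: x Fkx; exact/subsetPset/ndF/leq_maxl.
  - by move: y Gly; exact/subsetPset/ndG/leq_maxr.
move=> k; have [mFk Fkoo] := Foo k; have [mGk Gkoo] := Goo k; split.
  by rewrite -[X in measurable X]setTI; apply: measurable_tuple_uncons => //;
    exact: measurableX.
rewrite /cons_measure /pushforward -comp_preimage.
rewrite (_ : _ \o _ = id); last by apply/funext; exact: tuple_consK.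
by rewrite product_measure1E// lte_mul_pinfty// ge0_fin_numE.
Qed.

HB.instance Definition _ := Measure_isSigmaFinite.Build _ _ _
  cons_measure cons_measure_sigma_finite.

End cons_measure.

Fixpoint lebesgue_tuple n : {sigma_finite_measure set (n.-tuple mR) -> \bar R} :=
  match n with
  | 0 => [the {sigma_finite_measure set (0.-tuple mR) -> \bar R} of
           dirac [tuple]]
  | n'.+1 => [the {sigma_finite_measure set (n'.+1.-tuple mR) -> \bar R} of
           cons_measure (lebesgue_tuple n')]
  end.

End lebesgue_tuple.

Section polynomial_ensembles.
Context {R : realType}.
Local Notation mu := (@lebesgue_measure R).

Implicit Types (f w omega : R -> R) (n : nat).

(* A function on the positive half-line is a total function whose values
   outside `]0, +oo[ are ignored; it is extended by zero when regarded as a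
   function on the whole line. *)
Definition Rpos : set R := `]0, +oo[.

Definition ext0 (D : set R) f : R -> R := patch (fun=> 0) D f.

Definition mellin_interval (Sigma : set R) : Prop :=
  [/\ is_interval Sigma,
      exists s t, [/\ Sigma s, Sigma t & s < t],
      Sigma `<=` Rpos &
      forall k, (1 <= k)%N -> Sigma k%:R].

Definition mellin_L1 (Sigma : set R) f : Prop :=
  forall s, Sigma s ->
    mu.-integrable Rpos (fun x => (f x * x `^ (s - 1))%:E).

Definition PE_weight n (v : 'I_n -> R -> R) (x : n.-tuple R) : R :=
  (\prod_(j < n) \prod_(k < n | (j < k)%N) (tnth x k - tnth x j)) *
  \det (\matrix_(j < n, k < n) v j (tnth x k)).

Definition PE_norm n (v : 'I_n -> R -> R) : R :=
  \int[lebesgue_tuple n]_x PE_weight v x.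

Definition PE n (v : 'I_n -> R -> R) (x : n.-tuple R) : R :=
  (PE_norm v)^-1 * PE_weight v x.

Definition PE_well_defined n (v : 'I_n -> R -> R) : Prop :=
  [/\ forall j k : 'I_n, mu.-integrable setT (fun x => (x ^+ k * v j x)%:E),
      PE_norm v != 0 &
      \forall x \ae lebesgue_tuple n, 0 <= PE v x].

Definition PE_eq n (u v : 'I_n -> R -> R) : Prop :=
  [/\ PE_well_defined u, PE_well_defined v &
      \forall x \ae lebesgue_tuple n, PE u x = PE v x].

Definition OPE_fun n w (j : 'I_n) (x : R) : R := x ^+ j * w x.

Definition OPE_eq n w1 w2 : Prop := PE_eq (@OPE_fun n w1) (@OPE_fun n w2).

Definition abs_continuous_itv (a b : R) f : Prop :=
  forall e : R, 0 < e -> exists2 d : R, 0 < d &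
    forall m (s t : 'I_m -> R),
      (forall i, [/\ a <= s i, s i <= t i & t i <= b]) ->
      (forall i j, i != j -> t i <= s j \/ t j <= s i) ->
      \sum_(i < m) (t i - s i) < d ->
      \sum_(i < m) `|f (t i) - f (s i)| < e.

Definition loc_abs_continuous_pos f : Prop :=
  forall a b : R, 0 < a -> a < b -> abs_continuous_itv a b f.

Definition C_pos m f : Prop :=
  (forall k, (k < m)%N -> forall x : R, 0 < x -> derivable (derive1n k f) x 1) /\
  (forall x : R, 0 < x -> {for x, continuous (derive1n m f)}).

Definition euler f : R -> R := fun x => x * derive1 f x.

Definition ae_span n (v : 'I_n -> R -> R) : set (R -> R) :=
  [set f | exists c : 'I_n -> R,
     \forall x \ae mu, Rpos x -> f x = \sum_(i < n) c i * v i x].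

(* euler is total: iter n.-1 euler omega is the actual (x d/dx)^(n-1) omega
   only at the points, almost all by local absolute continuity, where the
   last derivative exists. *)
Definition mult_derivative_type_wrt n (v : 'I_n -> R -> R) omega : Prop :=
  ((2 <= n)%N ->
     C_pos (n - 2) omega /\ loc_abs_continuous_pos (derive1n (n - 2) omega)) /\
  ae_span v = ae_span (fun j : 'I_n => iter j euler omega).

Definition PE_mult_derivative_type n (v : 'I_n -> R -> R) : Prop :=
  PE_well_defined v /\ exists omega, mult_derivative_type_wrt v omega.

Definition OPE_mult_derivative_type n w : Prop :=
  PE_mult_derivative_type (@OPE_fun n w).

Definition jacobi_weight (a b : R) : R -> R :=
  ext0 `]0, 1[ (fun x => x `^ a * (1 - x) `^ (b - a - 1)).

Definition laguerre_weight (a : R) : R -> R :=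
  ext0 Rpos (fun x => x `^ a * expR (- x)).

Definition dilation (lambda : R) w : R -> R := fun x => w (lambda * x).

End polynomial_ensembles.

(* Main.v *)
Require Import Defs.
From mathcomp Require Import all_boot all_order all_algebra.
From mathcomp Require Import all_classical all_reals all_analysis.
From mathcomp Require Import zify perm measurable_realfun ring lra.

Import Order.TTheory GRing.Theory Num.Theory.
Import numFieldNormedType.Exports.

Local Open Scope classical_set_scope.
Local Open Scope ring_scope.

(** Already for [n = 2] the derivative-type condition makes [w] the quotient
[omega / p] of a solution of a linear differential equation
[x p(x) omega'(x) = q(x) omega(x)] by [p], where [p] and [q] are affine.  The
dilates of the two given weights are the only such quotients with finite
moments, and they satisfy the condition for every [n].

Necessity.  For [n = 2] the equality of spans gives affine [p], [q], neither of
them zero, with [omega = p w] and [x omega' = q w] almost everywhere on the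
half-line ([OPE2_relations]), hence the equation above wherever [omega] does
not vanish ([omega_ode]).  Since [omega] is locally absolutely continuous, on
each interval free of singular points it is a constant times
[exp (A ln x + B ln |x - r| - D / x + k x)] ([linear_ode_solution],
[omega_solution]), the exponent being a primitive of the partial fraction
expansion of [q(x) / (x p(x))].  When [p] has the root [r], or when [p] is
constant and [k >= 0], such a function decays at most polynomially, so
finiteness of all moments kills the constant near infinity
([tail_moments_eq0]).  Two possibilities remain: [p] is constant, [k < 0] and
[w] is proportional to [x^A exp (k x)]; or [r > 0] and [w] is proportional to
[x^A (r - x)^(B - 1)] on [(0, r)] and vanishes beyond [r].  Integrability of
[w] at [0] and at [r] forces the exponents to exceed [-1]
([OPE2_classification]).  Dilating by [- 1 / k] or by [r] gives the Laguerre or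
the Jacobi weight up to a factor.

Sufficiency.  The case [n = 1] of the equality of ensembles says that the
dilated weight is almost everywhere proportional to the Jacobi or Laguerre
weight.  In the Laguerre case [omega = w] works: the [j]-th Euler derivative of
[w] is [w] times a polynomial of degree exactly [j].  In the Jacobi case take
[omega = x^A (r - x)^(p + n - 1)], where [p > -1] is the exponent of [w] at
[r], [r] being the right end of the support: up to a factor its [j]-th Euler
derivative is [w] times [(r - x)^(n - 1 - j) P_j(x)] with [P_j] of degree at
most [j] and [P_j(r) <> 0].  These [n] polynomials have pairwise distinct
orders of vanishing at [r], so they span the polynomials of degree less than
[n] ([span_vanishing_ladder]).  The derivative of order
[n - 2] of [omega] behaves at [r] like the power [p + 1 > 0] of [r - x], which
is locally absolutely continuous ([abs_continuous_trunc_pow]).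

That the ensembles are well defined is transported along
dilations ([PE_well_defined_dilation]) and along proportionality of the weights
([PE_eq_proportional]). *)

(** * Dilations of Lebesgue measure *)

Section AlmostEverywhere.
Context {R : realType} {d : measure_display} {T : measurableType d}.
Context {m : {measure set T -> \bar R}}.

Lemma ae_mono {P Q : T -> Prop} : (forall x, P x -> Q x) ->
  (\forall x \ae m, P x) -> \forall x \ae m, Q x.
Proof. by move=> PQ; apply: (@filterS _ _ (ae_filter_ringOfSetsType m)). Qed.

Lemma ae_and {P Q : T -> Prop} : (\forall x \ae m, P x) ->
  (\forall x \ae m, Q x) -> \forall x \ae m, P x /\ Q x.
Proof. exact: (@filterI _ _ (ae_filter_ringOfSetsType m)). Qed.

End AlmostEverywhere.

Section Dilation.
Context {R : realType}.
Local Notation mR := (measurableTypeR R).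
Local Notation mu := (@lebesgue_measure R).

Lemma ge0_integral_scaling d (T : measurableType d) (m : {measure set T -> \bar R})
    (D : T -> T) (k : {nonneg R}) (f : T -> \bar R) :
    measurable_fun setT D ->
    (forall A, measurable A -> m (D @^-1` A) = (k%:num%:E * m A)%E) ->
    measurable_fun setT f -> (forall x, 0 <= f x)%E ->
  (\int[m]_x f (D x) = k%:num%:E * \int[m]_x f x)%E.
Proof.
move=> mD mDA mf f0.
have := @ge0_integral_pushforward _ _ _ _ R D mD m setT f measurableT mf (fun x _ => f0 x).
rewrite preimage_setT => <-.
rewrite -(@ge0_integral_mscale _ _ R m setT measurableT k f)//.
by apply: eq_measure_integral => A mA _; rewrite /= /pushforward/= mDA.
Qed.

(** The positive and negative parts scale separately; the infinite cases are
  compatible because multiplication by [k > 0] fixes both infinities. *)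
Lemma integral_scaling d (T : measurableType d) (m : {measure set T -> \bar R})
    (D : T -> T) (k : {nonneg R}) (f : T -> \bar R) : k%:num != 0 ->
    measurable_fun setT D ->
    (forall A, measurable A -> m (D @^-1` A) = (k%:num%:E * m A)%E) ->
    measurable_fun setT f ->
  (\int[m]_x f (D x) = k%:num%:E * \int[m]_x f x)%E.
Proof.
move=> k0 mD mDA mf; rewrite integralE [in RHS]integralE.
have -> : (fun x => f (D x))^\+%E = (fun x => f^\+ (D x))%E
  by apply/funext => x; rewrite ?funeposE ?funenegE.
have -> : (fun x => f (D x))^\-%E = (fun x => f^\- (D x))%E
  by apply/funext => x; rewrite ?funeposE ?funenegE.
rewrite (ge0_integral_scaling _ _ _ _ k (f^\+)%E)//; last exact: measurable_funepos.
rewrite (ge0_integral_scaling _ _ _ _ k (f^\-)%E)//; last exact: measurable_funeneg.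
have kgt0 : 0 < k%:num :> R by rewrite lt_neqAle eq_sym k0/=.
have ky : (k%:num%:E * +oo = +oo)%E by rewrite gt0_muley ?lte_fin.
have kNy : (k%:num%:E * -oo = -oo)%E by rewrite gt0_muleNy ?lte_fin.
have [a0 b0] : (0 <= \int[m]_x f^\+ x)%E /\ (0 <= \int[m]_x f^\- x)%E.
  by split; apply: integral_ge0.
case: (\int[m]_x f^\+ x)%E a0 => [a| |]// _; case: (\int[m]_x f^\- x)%E b0 => [b| |]// _.
- by rewrite -[RHS]/((k%:num * (a - b))%:E) mulrBr.
- by rewrite ky -[(a%:E - +oo)%E]/(-oo)%E kNy.
- by rewrite ky !addye.
- by rewrite ky -[(+oo - +oo)%E]/(-oo)%E kNy.
Qed.

Lemma lebesgue_measure_dilation (c : R) (A : set mR) : 0 < c -> measurable A ->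
  mu ((fun x => c * x) @^-1` A) = ((c^-1)%:E * mu A)%E.
Proof.
move=> c0 mA; pose f : mR -> mR := fun x => c * x.
have mf : measurable_fun setT f by exact: measurable_funM.
pose r : {nonneg R} := NngNum (ltW c0).
suff H : mu A = mscale r (pushforward mu f) A.
  rewrite (H mf) /mscale/= /pushforward muleA -EFinM mulVf ?gt_eqF// mul1e//.
move=> mf'; apply: lebesgue_measure_unique => //= _ [[a b]] _ <-.
rewrite -[LHS]/(mu `]a, b]%classic) -[RHS]/((c%:E * mu (f @^-1` `]a, b]%classic))%E).
rewrite (_ : f @^-1` _ = `](a / c), (b / c)]%classic); last first.
  by apply/seteqP; split=> x /=; rewrite !in_itv/= /f ltr_pdivrMr// ler_pdivlMr// (mulrC c).
rewrite !lebesgue_measure_itv/= !lte_fin ltr_pM2r ?invr_gt0//; case: ifPn => _.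
  by rewrite -!EFinB -EFinM; congr EFin; field; rewrite gt_eqF.
by rewrite mule0.
Qed.

Definition tuple_dilation (c : R) n (t : n.-tuple mR) : n.-tuple mR :=
  [tuple of map (fun x => c * x) t].

Lemma measurable_tuple_dilation c n : measurable_fun setT (@tuple_dilation c n).
Proof.
apply/measurable_fun_tnthP => i; rewrite (_ : _ \o _ = fun t => c * tnth t i).
  by apply: measurable_funM => //; exact: measurable_tnth.
by apply/funext => t /=; rewrite tnth_map.
Qed.

Lemma lebesgue_tupleSE n (A : set (n.+1.-tuple mR)) :
  (lebesgue_tuple n.+1 A =
   \int[mu]_x lebesgue_tuple n (xsection (@tuple_cons R n @^-1` A) x))%E.
Proof. by []. Qed.

(** Induction on the dimension: the section at [x] of the dilated set is the
  dilation of the section at [c * x]. *)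
Lemma lebesgue_tuple_dilation (c : R) n (A : set (n.-tuple mR)) : 0 < c ->
  measurable A ->
  lebesgue_tuple n (@tuple_dilation c n @^-1` A) = ((c^-1 ^+ n)%:E * lebesgue_tuple n A)%E.
Proof.
move=> c0; elim: n A => [|n IH] A mA.
  rewrite expr0 mul1e; congr (_ _); apply/seteqP; split => t /=;
    by rewrite (tuple0 t) (tuple0 (tuple_dilation _ _ _)).
rewrite !lebesgue_tupleSE; pose B := @tuple_cons R n @^-1` A.
have mB : measurable B.
  by rewrite -[X in measurable X]setTI; exact: measurable_tuple_cons.
have cV0 : 0 <= c^-1 ^+ n by rewrite exprn_ge0// invr_ge0 ltW.
have mphi := measurable_fun_xsection (lebesgue_tuple n) mB.
transitivity (\int[mu]_x ((c^-1 ^+ n)%:E * lebesgue_tuple n (xsection B (c * x)%R)))%E.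
  apply: eq_integral => x _; rewrite -IH; last exact: measurable_xsection.
  congr (_ _); apply/seteqP; split=> t; rewrite /xsection/= !inE/= /B/=;
    (have -> : tuple_dilation c n.+1 (tuple_cons (x, t)) =
      tuple_cons (c * x, tuple_dilation c n t) by exact/val_inj) => //.
rewrite ge0_integralZl//; last first.
  apply: (measurableT_comp mphi); exact: measurable_funM.
rewrite exprSr EFinM -muleA; congr (_ * _)%E.
pose k : {nonneg R} := NngNum (ltW (etrans (invr_gt0 c) c0)).
apply: (@ge0_integral_scaling _ mR mu (fun x => c * x) k (fun x => lebesgue_tuple n (xsection B x))).
- exact: measurable_funM.
- by move=> E mE; exact: (lebesgue_measure_dilation c E c0 mE).
- exact: mphi.
- by [].
Qed.

End Dilation.

(** * Polynomial ensembles under dilation and proportionality *)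

Section Ensembles.
Context {R : realType}.
Local Notation mR := (measurableTypeR R).
Local Notation mu := (@lebesgue_measure R).
Implicit Types (w : R -> R) (n : nat).

(** Tonelli: a slab with a null factor is null in the product measure, even when
  the other factor has infinite measure. *)
Lemma negligible_tnth n (N : set mR) : measurable N -> mu N = 0%E ->
  (lebesgue_tuple n) [set t | exists k, N (tnth t k)] = 0%E.
Proof.
move=> mN N0.
pose B m := [set t : m.-tuple mR | exists k, N (tnth t k)].
have mB m : measurable (B m).
  rewrite (_ : B m = \bigcup_(k in [set: 'I_m]) ((fun t => tnth t k) @^-1` N));
      last by apply/seteqP; split=> t [k]; exists k.
  apply: fin_bigcup_measurable => // k _.
  by rewrite -[X in measurable X]setTI; exact: measurable_tnth.
elim: n => [|n IH].
  by rewrite (_ : [set _ | _] = set0) ?measure0//; apply/seteqP; split=> t []//; case.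
rewrite -[LHS]/((mu \x lebesgue_tuple n)%E (@tuple_cons R n @^-1` B n.+1)).
rewrite (_ : _ @^-1` _ = (N `*` setT) `|` (setT `*` B n)); last first.
  apply/seteqP; split => [[h t]|[h t]]; rewrite /B/=.
    move=> [k]; rewrite (tnth_nth h)/=; case: (unliftP ord0 k) => [j ->|->]/=.
      by move=> Nj; right; split=> //; exists j; rewrite (tnth_nth h).
    by move=> Nh; left.
  move=> [[Nh _]|[_ [j Nj]]].
    by exists ord0; rewrite (tnth_nth h).
  by exists (lift ord0 j) => /=; move: Nj; rewrite !(tnth_nth h)/=.
rewrite [LHS]measureU0; [|exact: measurableX|by apply: measurableX => //; exact: mB|].
- by rewrite [LHS]product_measure1E// [X in (X * _)%E]N0 mul0e.
- by rewrite [LHS]product_measure1E//; [rewrite [X in (_ * X)%E]IH mule0|exact: mB].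
Qed.

Lemma ae_tnth n (P : R -> Prop) : (\forall x \ae mu, P x) ->
  \forall x \ae lebesgue_tuple n, forall k : 'I_n, P (tnth x k).
Proof.
move=> [N [mN N0 PN]].
exists [set t | exists k, N (tnth t k)]; split; [|exact: negligible_tnth|].
  rewrite (_ : [set _ | _] = \bigcup_(k in [set: 'I_n]) ((fun t : n.-tuple mR => tnth t k) @^-1` N));
      last by apply/seteqP; split=> t [k]; exists k.
  apply: fin_bigcup_measurable => // k _.
  by rewrite -[X in measurable X]setTI; exact: measurable_tnth.
move=> t /= /existsNP[k nP]; exists k; exact: PN.
Qed.

Lemma ae_tuple1 (P : R -> Prop) :
  (\forall x \ae lebesgue_tuple 1, P (tnth x ord0)) -> \forall x \ae mu, P x.
Proof.
move=> [A [mA A0 PA]].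
pose B := @tuple_cons R 0 @^-1` A.
have mB : measurable B.
  by rewrite -[X in measurable X]setTI; exact: measurable_tuple_cons.
have mN : measurable [set x : mR | B (x, [tuple])].
  rewrite (_ : [set _ | _] = ysection B [tuple]); first exact: measurable_ysection.
  by apply/seteqP; split=> x; rewrite /ysection/= inE.
exists [set x : mR | B (x, [tuple])]; split => //.
- rewrite -A0 lebesgue_tupleSE -[in LHS](setIT [set x : mR | B (x, [tuple])]).
  rewrite -[LHS]integral_indic//; apply: eq_integral => x _.
  rewrite [RHS]diracE indicE; congr ((nat_of_bool _)%:R%:E).
  by apply/idP/idP; rewrite /xsection/= !inE /= inE.
- by move=> x /= nP; apply: PA => /=; rewrite (tnth_nth x).
Qed.

Lemma measurable_PE_weight n w : measurable_fun (setT : set mR) w ->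
  measurable_fun setT (PE_weight (@OPE_fun R n w)).
Proof.
move=> mw; apply: measurable_funM.
  apply: measurable_prod => j _; under eq_fun do rewrite big_mkcond.
  apply: measurable_prod => k _; case: (j < k)%N => //.
  by apply: measurable_funB; exact: measurable_tnth.
rewrite /determinant; apply: measurable_sum => s; apply: measurable_funM => //.
apply: measurable_prod => i _.
rewrite (_ : (fun x => _) = fun x : n.-tuple mR =>
   tnth x (s i) ^+ i * w (tnth x (s i))); last by apply/funext => x; rewrite mxE.
apply: measurable_funM; first by apply: measurable_funX; exact: measurable_tnth.
by apply: (measurableT_comp mw); exact: measurable_tnth.
Qed.

(** The real integral of a function whose integral is infinite or undefined is
  [0] by convention, so a nonzero normalization constant carries an
  integrability statement. *)
Lemma Rintegral_neq0_integrable d (T : measurableType d)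
    (m : {measure set T -> \bar R}) (f : T -> R) : measurable_fun setT f ->
  \int[m]_x f x != 0 -> m.-integrable setT (EFin \o f).
Proof.
move=> mf; rewrite /Rintegral => I0.
have mEf : measurable_fun setT (EFin \o f) by exact/measurable_EFinP.
have fin : (\int[m]_x (f x)%:E)%E \is a fin_num.
  by move: I0; case: (integral _ _ _) => //=; rewrite eqxx.
apply/integrableP; split=> //.
have [a0 b0] : (0 <= \int[m]_x (EFin \o f)^\+ x)%E /\ (0 <= \int[m]_x (EFin \o f)^\- x)%E.
  by split; apply: integral_ge0.
move: fin; rewrite integralE.
rewrite [X in _ -> (X < _)%E](eq_integral
  (fun x => (EFin \o f)^\+ x + (EFin \o f)^\- x)%E); last first.
  by move=> x _; rewrite -[LHS]/((abse \o (EFin \o f)) x) fune_abse.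
rewrite ge0_integralD//; last 2 first.
- exact: measurable_funepos.
- exact: measurable_funeneg.
by case: (\int[m]_x (EFin \o f)^\+ x)%E a0 => [a| |]// _;
  case: (\int[m]_x (EFin \o f)^\- x)%E b0 => [b| |]// _ _; rewrite ltry.
Qed.

Lemma ae_scaling d (T : measurableType d) (m : {measure set T -> \bar R})
    (D : T -> T) (k : R) (P : T -> Prop) : measurable_fun setT D ->
    (forall A, measurable A -> m (D @^-1` A) = (k%:E * m A)%E) ->
  (\forall x \ae m, P x) -> \forall x \ae m, P (D x).
Proof.
move=> mD mDA [N [mN N0 PN]]; exists (D @^-1` N); split.
- by rewrite -[X in measurable X]setTI; exact: mD.
- by rewrite mDA// N0 mule0.
- by move=> x /= nP; exact: PN.
Qed.

(** The Vandermonde factor is homogeneous, and the determinant picks up one power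
  of [c] per row; both factors are independent of the weight. *)
Lemma PE_weight_dilation (c : R) n : 0 < c -> exists2 K : R, 0 < K &
  forall w (x : n.-tuple R), PE_weight (@OPE_fun R n w) (tuple_dilation c n x) =
    K * PE_weight (@OPE_fun R n (dilation c w)) x.
Proof.
move=> c0; pose K1 := \prod_(j < n) \prod_(k < n | (j < k)%N) c.
pose K2 := \prod_(j < n) c ^+ j.
exists (K1 * K2).
  by rewrite mulr_gt0// prodr_gt0// => j _; rewrite ?exprn_gt0// prodr_gt0.
move=> w x; rewrite /PE_weight.
have -> : \prod_(j < n) \prod_(k < n | (j < k)%N)
    (tnth (tuple_dilation c n x) k - tnth (tuple_dilation c n x) j) =
    K1 * \prod_(j < n) \prod_(k < n | (j < k)%N) (tnth x k - tnth x j).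
  rewrite -big_split/=; apply: eq_bigr => j _.
  rewrite -big_split/=; apply: eq_bigr => k _.
  by rewrite !tnth_map mulrBr.
have -> : \matrix_(j < n, k < n) @OPE_fun R n w j (tnth (tuple_dilation c n x) k) =
    diag_mx (\row_(j < n) c ^+ j) *m
    \matrix_(j < n, k < n) @OPE_fun R n (dilation c w) j (tnth x k).
  apply/matrixP => j k; rewrite mul_diag_mx !mxE /OPE_fun /dilation tnth_map.
  by rewrite exprMn mulrA.
rewrite det_mulmx det_diag.
have -> : \prod_i (\row_(j < n) c ^+ j) ord0 i = K2.
  by apply: eq_bigr => j _; rewrite mxE.
ring.
Qed.

Lemma integrable_dilation (c : R) (f : R -> R) : 0 < c ->
  mu.-integrable setT (EFin \o f) ->
  mu.-integrable setT (EFin \o (fun x => f (c * x))).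
Proof.
move=> c0 /integrableP[mf fi].
have mc : measurable_fun (setT : set mR) (fun x : mR => c * x : mR).
  exact: measurable_funM.
apply/integrableP; split; first exact: (measurableT_comp mf mc).
pose k : {nonneg R} := NngNum (ltW (etrans (invr_gt0 c) c0)).
have := @ge0_integral_scaling R _ mR mu (fun x => c * x) k
  (fun x => `|(f x)%:E|)%E mc _ _ (fun x => abse_ge0 _).
move=> ->; last 2 first.
- by move=> A mA; exact: lebesgue_measure_dilation.
- exact: measurableT_comp mf.
by rewrite lte_mul_pinfty// lee_fin.
Qed.

(** Change of variables on the whole space; the constants cancel up to the
  Jacobian, which is positive and so keeps the sign of the density. *)
Lemma PE_well_defined_dilation (c : R) n w : 0 < c ->
  measurable_fun (setT : set mR) w ->
  PE_well_defined (@OPE_fun R n w) -> PE_well_defined (@OPE_fun R n (dilation c w)).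
Proof.
move=> c0 mw [int_w norm_w pos_w].
have [K K0 HK] := PE_weight_dilation c n c0.
have mD := measurable_tuple_dilation c n.
have cn0 : 0 < c^-1 ^+ n by rewrite exprn_gt0// invr_gt0.
pose k : {nonneg R} := NngNum (ltW cn0).
have mDA A : measurable A -> lebesgue_tuple n (tuple_dilation c n @^-1` A) =
    (k%:num%:E * lebesgue_tuple n A)%E.
  exact: lebesgue_tuple_dilation.
have mdw : measurable_fun (setT : set mR) (dilation c w).
  by apply: (measurableT_comp mw); exact: measurable_funM.
have normE : PE_norm (@OPE_fun R n (dilation c w)) =
    K^-1 * c^-1 ^+ n * PE_norm (@OPE_fun R n w).
  have mW := measurable_PE_weight n w mw.
  have iW : (lebesgue_tuple n).-integrable setT (EFin \o PE_weight (@OPE_fun R n w)).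
    exact: (@Rintegral_neq0_integrable _ _ (lebesgue_tuple n) _ mW norm_w).
  rewrite /PE_norm mulrAC -[X in _ = X * _](RintegralZl (K^-1) measurableT iW).
  rewrite /Rintegral mulrC -[c^-1 ^+ n]/(fine ((c^-1 ^+ n)%:E)) -fineM//; last first.
    apply: (integrable_fin_num measurableT).
    exact: (integrableZl measurableT K^-1 iW).
  rewrite -(@integral_scaling R _ _ (lebesgue_tuple n) (tuple_dilation c n) k
      (fun x => (K^-1 * PE_weight (@OPE_fun R n w) x)%:E))//.
  - by congr fine; apply: eq_integral => x _; rewrite HK mulKf// gt_eqF.
  - by rewrite gt_eqF.
  - by apply/measurable_EFinP; exact: measurable_funM.
split.
- move=> j l; have := integrable_dilation c _ c0 (int_w j l).
  move=> /(integrableZl measurableT (c^-1 ^+ (l + j))).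
  congr (integrable _ _ _); apply/funext => x /=.
  rewrite /OPE_fun /dilation -EFinM !exprMn exprD !exprVn; congr EFin; field.
  by rewrite !expf_neq0 ?gt_eqF.
- by rewrite normE !mulf_neq0// gt_eqF// invr_gt0.
- have := ae_scaling _ _ (lebesgue_tuple n) _ _ _ mD mDA pos_w.
  apply: ae_mono => x /=.
  rewrite /PE normE HK => W0.
  rewrite (_ : _ * _ = c ^+ n * ((PE_norm (@OPE_fun R n w))^-1 *
      (K * PE_weight (@OPE_fun R n (dilation c w)) x))).
    by rewrite mulr_ge0// exprn_ge0// ltW.
  rewrite exprVn; field; rewrite (gt_eqF K0) norm_w expf_neq0// gt_eqF//.
Qed.

(** The factor [kappa ^ n] appears both in the unnormalized density and in the
  normalization constant, so it cancels in the density whatever its sign. *)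
Lemma PE_eq_proportional n w1 w2 (kappa : R) : kappa != 0 ->
    measurable_fun (setT : set mR) w1 -> measurable_fun (setT : set mR) w2 ->
    (\forall x \ae mu, w1 x = kappa * w2 x) ->
    PE_well_defined (@OPE_fun R n w1) ->
  PE_eq (@OPE_fun R n w1) (@OPE_fun R n w2).
Proof.
move=> k0 mw1 mw2 w12 wd1.
have [int_w1 norm_w1 pos_w1] := wd1.
have mW1 := measurable_PE_weight n w1 mw1.
have mW2 := measurable_PE_weight n w2 mw2.
have W21 : \forall x \ae lebesgue_tuple n,
    PE_weight (@OPE_fun R n w2) x = kappa ^- n * PE_weight (@OPE_fun R n w1) x.
  move: (ae_tnth n _ w12).
  apply: ae_mono => x wx.
  rewrite /PE_weight; have -> : \matrix_(j < n, k < n) @OPE_fun R n w1 j (tnth x k) =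
      kappa *: \matrix_(j < n, k < n) @OPE_fun R n w2 j (tnth x k).
    by apply/matrixP => j l; rewrite !mxE /OPE_fun wx; ring.
  by rewrite detZ mulrCA [X in _ = _ * X]mulrA mulVf ?expf_neq0// mul1r.
have iW1 : (lebesgue_tuple n).-integrable setT (EFin \o PE_weight (@OPE_fun R n w1)).
  exact: (@Rintegral_neq0_integrable _ _ (lebesgue_tuple n) _ mW1 norm_w1).
have normE : PE_norm (@OPE_fun R n w2) = kappa ^- n * PE_norm (@OPE_fun R n w1).
  rewrite /PE_norm -[RHS](RintegralZl (kappa ^- n) measurableT iW1).
  rewrite /Rintegral; congr fine; apply: ae_eq_integral => //.
  - exact/measurable_EFinP.
  - by apply/measurable_EFinP; exact: measurable_funM.
  - move: W21; apply: ae_mono.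
    by move=> x -> _.
have PE21 : \forall x \ae lebesgue_tuple n,
    PE (@OPE_fun R n w1) x = PE (@OPE_fun R n w2) x.
  move: W21; apply: ae_mono => x.
  rewrite /PE normE => ->; field.
  by rewrite norm_w1 expf_neq0.
split=> //; split.
- move=> j l; have /integrableP[_ fi] := int_w1 j l.
  have mf (w : R -> R) : measurable_fun (setT : set mR) w ->
      measurable_fun setT (fun x : mR => (x ^+ l * @OPE_fun R n w j x)%:E).
    move=> mw; apply/measurable_EFinP; apply: measurable_funM => //.
    exact: measurable_funM.
  have : mu.-integrable setT (fun x => (x ^+ l * @OPE_fun R n w1 j x)%:E) := int_w1 j l.
  move=> /(integrableZl measurableT kappa^-1) /integrableP[mg gi].
  apply/integrableP; split; first exact: mf.
  rewrite (_ : integral _ _ _ = \int[mu]_x `|(kappa^-1%:E * (x ^+ l * OPE_fun w1 j x)%:E)|)%E//.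
  apply: ae_eq_integral => //.
  + by apply: measurableT_comp => //; exact: mf.
  + exact: measurableT_comp.
  + move: w12; apply: ae_mono => x wx _.
    rewrite -EFinM /OPE_fun wx; congr (`| _%:E |)%E; field.
    exact: k0.
- by rewrite normE mulf_neq0// invr_neq0// expf_neq0.
- move: PE21 pos_w1.
  by move=> PE12 pos; move: (ae_and PE12 pos); apply: ae_mono => x [<-].
Qed.

Lemma PE_weight1 w (x : 1.-tuple R) : PE_weight (@OPE_fun R 1 w) x = w (tnth x ord0).
Proof.
rewrite /PE_weight big_ord1 big_pred0 ?mul1r; last by move=> [[]].
by rewrite det_mx11 mxE /OPE_fun expr0 mul1r.
Qed.

(** For a single particle the density is the normalized weight itself. *)
Lemma PE_eq1_proportional w1 w2 : PE_eq (@OPE_fun R 1 w1) (@OPE_fun R 1 w2) ->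
  exists2 kappa : R, kappa != 0 & \forall x \ae mu, w1 x = kappa * w2 x.
Proof.
move=> [[_ n1 _] [_ n2 _] e12].
exists (PE_norm (@OPE_fun R 1 w1) / PE_norm (@OPE_fun R 1 w2)).
  by rewrite mulf_neq0// invr_neq0.
apply: ae_tuple1; move: e12.
apply: ae_mono => x.
rewrite /PE !PE_weight1 => e; rewrite -mulrA -e mulrA mulfV// mul1r//.
Qed.

Lemma ae_dilation (c : R) (P : R -> Prop) : 0 < c ->
  (\forall x \ae mu, P x) -> \forall x \ae mu, P (c * x).
Proof.
move=> c0; apply: (@ae_scaling _ mR mu (fun x => c * x) c^-1).
  exact: measurable_funM.
by move=> A mA; exact: lebesgue_measure_dilation.
Qed.

End Ensembles.

(** * Absolutely continuous functions *)

Section AbsoluteContinuity.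
Context {R : realType}.
Local Notation mu := (@lebesgue_measure R).
Implicit Types (f g h : R -> R) (a b : R).

(** Non-overlapping intervals have disjoint interiors, so their lengths add up to
  the measure of a subset of [U]. *)
Lemma sum_length_le m (s t : 'I_m -> R) (U : set R) : measurable U ->
    (forall i, s i <= t i) -> (forall i, `]s i, t i[%classic `<=` U) ->
    (forall i j, i != j -> t i <= s j \/ t j <= s i) ->
  ((\sum_(i < m) (t i - s i))%:E <= mu U)%E.
Proof.
move=> mU st stU dis.
have -> : ((\sum_(i < m) (t i - s i))%:E =
    \sum_(i < m) mu `]s i, t i[%classic)%E.
  rewrite -sumEFin; apply: eq_bigr => i _.
  rewrite lebesgue_measure_itv/= lte_fin; case: ltP => // tis.
  by rewrite (@le_anti _ _ (s i) (t i)) ?subrr// st tis.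
have <- : mu (\big[setU/set0]_(i < m) `]s i, t i[%classic) =
    (\sum_(i < m) mu `]s i, t i[%classic)%E.
  apply: measure_bigsetU_ord => [i|]; first exact: measurable_itv.
  apply/trivIsetP => i j _ _ /dis ij; apply/seteqP; split=> // x [/=].
  by rewrite !in_itv/= => /andP[? ?] /andP[? ?]; case: ij => ?; lra.
apply: le_measure; rewrite ?inE//; first exact: bigsetU_measurable.
by move=> x; elim/big_ind: _ => [[]|A B HA HB [/HA|/HB]|i _ /stU].
Qed.

(** Induction along the interval: the supremum of the points reached from [a]
  is itself reached, and cannot lie before [b]. *)
Lemma real_induction (S : R -> Prop) a b : a <= b -> S a ->
    (forall c, a <= c <= b -> exists2 eta : R, 0 < eta &
      forall x y, a <= x -> x <= c -> c <= y -> y <= b ->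
        c - eta < x -> y < c + eta -> S x -> S y) ->
  S b.
Proof.
move=> ab Sa step; pose T := [set t | a <= t <= b /\ S t].
have Ta : T a by split=> //; rewrite lexx.
have bT : ubound T b by move=> t [/andP[]].
have supT : has_sup T by split; [exists a | exists b].
have acb : a <= sup T <= b.
  by rewrite ge_sup ?andbT//; [exact: ub_le_sup (ex_intro _ b bT) _ Ta | exists a].
have [eta eta0 He] := step _ acb; move/andP: acb => [ac cb].
have [x [/andP[ax xb] Sx] cx] := sup_adherent eta0 supT.
have xc : x <= sup T.
  by apply: ub_le_sup; [exists b | split=> //; rewrite ax].
have Sy y : sup T <= y -> y <= b -> y < sup T + eta -> S y.
  by move=> ? ? ?; exact: (He x).
have [cb'|bc] := ltP (sup T) b; last first.
  by apply: Sy; lra.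
pose y := Num.min b (sup T + eta / 2).
have yc : sup T < y by rewrite lt_min cb'/=; lra.
have yb : y <= b by rewrite ge_min lexx.
have Ty : T y.
  split; first by lra.
  by apply: Sy => //; [exact: ltW | rewrite gt_min; apply/orP; right; lra].
have := ub_le_sup (ex_intro _ b bT) Ty.
by lra.
Qed.

Lemma is_derive0_small h (x : R) : is_derive x 1 h 0 -> forall e, 0 < e ->
  exists2 eta : R, 0 < eta &
    forall y, `|y - x| < eta -> `|h y - h x| <= e * `|y - x|.
Proof.
move=> [dh d0] e e0; rewrite /derive in d0.
have /cvgrPdist_lt /(_ e e0) : k^-1 *: (h (k%:A + x) - h x) @[k --> 0^'] --> (0:R).
  by rewrite -[X in _ --> X]d0; exact: dh.
rewrite -nbhs_nearE => /nbhs_ballP[eta /= eta0 H].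
exists eta => // y yx; have [->|nyx] := eqVneq y x.
  by rewrite !subrr normr0 mulr0.
have yx0 : y - x != 0 by rewrite subr_eq0.
have := H (y - x); rewrite /ball/= sub0r normrN => /(_ yx yx0).
rewrite sub0r normrN scaler1 subrK normrZ normfV => /ltW.
by rewrite ler_pdivrMl ?normr_gt0// mulrC.
Qed.

Lemma negligible_open (N : set R) (e : R) : mu.-negligible N -> 0 < e ->
  exists U : set R, [/\ open U, N `<=` U & (mu U < e%:E)%E].
Proof.
move=> [A [mA A0 NA]] e0.
have Aoo : (mu A < +oo)%E by rewrite [ltLHS]A0.
have [U [oU AU UA]] := lebesgue_regularity_outer mA Aoo e0.
exists U; split=> //; first exact: subset_trans AU.
rewrite -(setDUK AU) measureU//.
- by rewrite [X in (X + _ < _)%E]A0 add0e.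
- by apply: measurableD => //; exact: open_measurable.
- by rewrite setDE setICA setICr setI0.
Qed.

Lemma abs_continuous_itvS a b a' b' h : a <= a' -> b' <= b ->
  abs_continuous_itv a b h -> abs_continuous_itv a' b' h.
Proof.
move=> aa bb H e /H[d d0 {}H]; exists d => // m s t st.
apply: H => i; have [? ? ?] := st i; split=> //; lra.
Qed.

(** Enclose the exceptional null set in an open set [U] of small measure and walk
  from [a] to [b] in small steps.  A step around a point of [U] stays in [U]:
  absolute continuity bounds the total variation of all these steps.  A step
  around any other point has increment at most [e] times its length. *)
Lemma abs_continuous_derive0_const h a b : a <= b -> abs_continuous_itv a b h ->
    (\forall x \ae mu, a < x -> x < b -> is_derive x 1 h 0) ->
  h a = h b.
Proof.
move=> ab ACh dh.
suff H e : 0 < e -> `|h b - h a| <= e * (b - a + 1).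
  apply/esym/subr0_eq/eqP; rewrite -normr_eq0 eq_le normr_ge0 andbT.
  apply/ler_addgt0Pr => e e0; rewrite add0r.
  have p : 0 < b - a + 1 by lra.
  have := H (e / (b - a + 1)); rewrite divfK; last by rewrite gt_eqF.
  by apply; rewrite divr_gt0.
move=> e0; have [d d0 {}ACh] := ACh e e0.
(* The end points are put in the exceptional set, so that every point outside
   of it is an interior point at which h has derivative zero. *)
pose N := [set x | ~ (a < x -> x < b -> is_derive x 1 h 0)] `|` [set a; b].
have negN : mu.-negligible N.
  apply: negligibleU; first exact: dh.
  exists [set a; b]; split=> //; first exact: measurableU.
  by apply: countable_lebesgue_measure0; exact: finite_set_countable.
have [U [oU NU Ud]] := negligible_open _ _ negN d0.
have mU : measurable U by exact: open_measurable.
(* S x: from a to x, h has slope at most e up to its increments over finitely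
   many non-overlapping intervals inside U. *)
pose S x := exists m (s t : 'I_m -> R),
  [/\ forall i, [/\ a <= s i, s i <= t i & t i <= x],
      forall i, `]s i, t i[%classic `<=` U,
      forall i j, i != j -> t i <= s j \/ t j <= s i &
      `|h x - h a| <= e * (x - a) + \sum_(i < m) `|h (t i) - h (s i)|].
have : S b.
  apply: (@real_induction S a b ab).
    exists 0%N, (fun=> a), (fun=> a); split; try by case.
    by rewrite !subrr mulr0 big_ord0 normr0 addr0.
  move=> c acb.
  (* A step around c either keeps the family of intervals or adds [x, y] to it. *)
  have [Uc|nUc] := pselect (U c); last first.
    have dc : is_derive c 1 h 0.
      apply: contrapT => ndc; apply/nUc/NU.
      have [[ac cb]|nc] := pselect (a < c /\ c < b).
        by left => H; exact: ndc (H ac cb).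
      right => /=; move/andP: acb => [].
      rewrite le_eqVlt => /predU1P[->|ac]; first by left.
      rewrite le_eqVlt => /predU1P[->|cb]; first by right.
      by case: nc.
    have [eta eta0 He] := is_derive0_small _ _ dc _ e0.
    exists eta => // x y ax xc cy yb xe ye [m [s [t [st stU dis hx]]]].
    exists m, s, t; split=> //.
      by move=> i; have [? ? ?] := st i; split=> //; lra.
    have hy : `|h y - h c| <= e * (y - c).
      by rewrite -[in leRHS](@ger0_norm _ (y - c)) ?subr_ge0// He// ger0_norm; lra.
    have hx' : `|h c - h x| <= e * (c - x).
      rewrite distrC -[in leRHS](@ger0_norm _ (c - x)) ?subr_ge0// distrC.
      by rewrite [in leRHS]distrC distrC He// distrC ger0_norm; lra.
    have -> : h y - h a = (h y - h c) + (h c - h x) + (h x - h a) by ring.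
    rewrite (le_trans (ler_normD _ _))// (le_trans (lerD (ler_normD _ _) (lexx _)))//.
    by nra.
  have /nbhs_ballP[eta /= eta0 He] : nbhs c U by exact: open_nbhs_nbhs.
  exists eta => // x y ax xc cy yb xe ye [m [s [t [st stU dis hx]]]].
  pose s' (i : 'I_m.+1) := oapp s x (unlift ord0 i).
  pose t' (i : 'I_m.+1) := oapp t y (unlift ord0 i).
  exists m.+1, s', t'; split.
  - move=> i; rewrite /s' /t'; case: (unliftP ord0 i) => [j _|_] /=.
      by have [? ? ?] := st j; split=> //; lra.
    by split; lra.
  - move=> i; rewrite /s' /t'; case: (unliftP ord0 i) => [j _|_] //=.
    move=> z /=; rewrite in_itv/= => /andP[xz zy]; apply: He.
    by rewrite /ball/= ltr_norml; apply/andP; split; lra.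
  - move=> i j; rewrite /s' /t'.
    case: (unliftP ord0 i) => [k ik|i0]; case: (unliftP ord0 j) => [l jl|j0] /=.
    + by rewrite ik jl (inj_eq lift_inj); exact: dis.
    + by have [? ? ?] := st k; left; lra.
    + by have [? ? ?] := st l; right; lra.
    + by rewrite i0 j0 eqxx.
  - rewrite big_ord_recl /s' /t' unlift_none/=.
    under eq_bigr do rewrite liftK/=.
    have -> : h y - h a = (h y - h x) + (h x - h a) by ring.
    have : e * (x - a) <= e * (y - a) by rewrite ler_pM2l//; lra.
    have := ler_normD (h y - h x) (h x - h a); lra.
move=> [m [s [t [st stU dis hb]]]].
have : \sum_(i < m) `|h (t i) - h (s i)| < e.
  apply: ACh => //; rewrite -lte_fin; apply: le_lt_trans Ud.
  by apply: sum_length_le => // i; have [] := st i.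
lra.
Qed.

End AbsoluteContinuity.

(** * Linear differential equations for absolutely continuous functions *)

Section LinearODE.
Context {R : realType}.
Local Notation mu := (@lebesgue_measure R).
Implicit Types (f g h : R -> R) (a b : R).

Lemma continuous_bounded_itv a b f : (forall x, a <= x <= b -> {for x, continuous f}) ->
  exists2 M : R, 0 <= M & forall x, a <= x <= b -> `|f x| <= M.
Proof.
move=> cf; have [ab|ba] := leP a b; last first.
  by exists 0 => // x /andP[]; lra.
have cnf : {within `[a, b], continuous (fun x => `|f x|)}.
  apply: continuous_in_subspaceT => x; rewrite inE/= in_itv/= => xab.
  by apply: cvg_norm; exact: cf.
have [c _ cmax] := EVT_max ab cnf.
exists `|f c| => // x xab; apply: cmax; rewrite in_itv/=; exact: xab.
Qed.

Lemma C1_lipschitz_itv a b g g' :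
    (forall x : R, a <= x <= b -> is_derive x 1 g (g' x)) ->
    (forall x, a <= x <= b -> {for x, continuous g'}) ->
  exists2 K : R, 0 <= K & forall x y, a <= x -> x <= y -> y <= b ->
    `|g y - g x| <= K * (y - x).
Proof.
move=> dg cg'; have [K K0 HK] := continuous_bounded_itv _ _ _ cg'.
exists K => // x y ax xy yb.
have xyab z : z \in `[x, y] -> a <= z <= b.
  by rewrite in_itv/= => /andP[? ?]; apply/andP; split; lra.
have [||c cxy ->] := @MVT_segment R g g' x y xy.
- by move=> z zxy; apply: dg; apply: xyab; exact: subset_itv_oo_cc zxy.
- apply: continuous_in_subspaceT => z; rewrite inE/= => zxy.
  apply: differentiable_continuous; apply/derivable1_diffP.
  by have [] := dg _ (xyab _ zxy).
- by rewrite normrM (ger0_norm (x := y - x)) ?subr_ge0// ler_wpM2r ?subr_ge0// HK// xyab.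
Qed.

Lemma abs_continuous_lipschitz a b g K :
    (forall x y, a <= x -> x <= y -> y <= b -> `|g y - g x| <= K * (y - x)) ->
  abs_continuous_itv a b g.
Proof.
move=> lip e e0; have K1 : 0 < `|K| + 1 by rewrite ltr_wpDl.
exists (e / (`|K| + 1)); first by rewrite divr_gt0.
move=> m s t st _; rewrite ltr_pdivlMr// mulrC => /(le_lt_trans _); apply.
rewrite mulr_sumr; apply: ler_sum => i _; have [? ? ?] := st i.
rewrite (le_trans (lip _ _ _ _ _))// ler_wpM2r ?subr_ge0//.
by rewrite (le_trans (ler_norm K))// lerDl.
Qed.

Lemma abs_continuousM a b f g F G :
    (forall x, a <= x <= b -> `|f x| <= F) ->
    (forall x, a <= x <= b -> `|g x| <= G) ->
    abs_continuous_itv a b f -> abs_continuous_itv a b g ->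
  abs_continuous_itv a b (fun x => f x * g x).
Proof.
move=> fF gG ACf ACg e e0.
have M0 : 0 < 2 * (`|F| + `|G| + 1) by rewrite mulr_gt0// ltr_wpDl// addr_ge0.
have e'0 : 0 < e / (2 * (`|F| + `|G| + 1)) by rewrite divr_gt0.
have [d1 d10 H1] := ACf _ e'0; have [d2 d20 H2] := ACg _ e'0.
exists (Num.min d1 d2); first by rewrite lt_min d10.
move=> m s t st dis; rewrite lt_min => /andP[/(H1 _ _ _ st dis){}H1 /(H2 _ _ _ st dis){}H2].
set M := `|F| + `|G| + 1 in M0 e'0 H1 H2.
apply: (@le_lt_trans _ _ (\sum_(i < m) (M * `|f (t i) - f (s i)| + M * `|g (t i) - g (s i)|))).
  apply: ler_sum => i _; have [asi sti tib] := st i.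
  have -> : f (t i) * g (t i) - f (s i) * g (s i) =
    (f (t i) - f (s i)) * g (t i) + f (s i) * (g (t i) - g (s i)) by ring.
  rewrite (le_trans (ler_normD _ _))// !normrM [X in X + _]mulrC.
  apply: lerD; apply: ler_wpM2r => //.
  - rewrite (le_trans (gG _ _)) ?(le_trans (ler_norm G)) ?/M//; first lra.
    have := normr_ge0 F; lra.
  - rewrite (le_trans (fF _ _)) ?(le_trans (ler_norm F)) ?/M//; first lra.
    have := normr_ge0 G; lra.
rewrite big_split/= -!mulr_sumr.
have M00 : 0 < M by lra.
have : M * \sum_(i < m) `|f (t i) - f (s i)| < e / 2.
  rewrite -ltr_pdivlMl// (lt_le_trans H1)//.
  by rewrite le_eqVlt; apply/orP; left; apply/eqP; field; rewrite gt_eqF.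
have : M * \sum_(i < m) `|g (t i) - g (s i)| < e / 2.
  rewrite -ltr_pdivlMl// (lt_le_trans H2)//.
  by rewrite le_eqVlt; apply/orP; left; apply/eqP; field; rewrite gt_eqF.
lra.
Qed.

(** By connectedness only a local statement is needed, in a form that also
  covers the zeros of [h]: near each point, [h] takes a given nonzero value
  [k] either everywhere or nowhere.  Near a zero of [h] it does so nowhere, by
  continuity; elsewhere [h] is constant because its derivative vanishes. *)
Lemma abs_continuous_locally_const h a b : a <= b ->
    (forall x, a <= x <= b -> {for x, continuous h}) ->
    abs_continuous_itv a b h ->
    (\forall x \ae mu, a < x -> x < b -> h x != 0 -> is_derive x 1 h 0) ->
  h a = h b.
Proof.
move=> ab ch ACh dh.
have loc k : k != 0 -> forall c, a <= c <= b -> exists2 eta : R, 0 < eta &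
    forall x y, a <= x -> x <= c -> c <= y -> y <= b ->
      c - eta < x -> y < c + eta -> (h x = k <-> h y = k).
  move=> k0 c cab; have [hc0|hc0] := eqVneq (h c) 0.
    have /cvgrPdist_lt/(_ `|k|) := ch _ cab; rewrite normr_gt0 => /(_ k0).
    rewrite -nbhs_nearE => /nbhs_ballP[eta /= eta0 H].
    exists eta => // x y ax xc cy yb xe ye.
    have nk z : c - eta < z -> z < c + eta -> h z <> k.
      move=> zl zu hz; have /H/= : ball c eta z.
        by rewrite /ball/= ltr_norml; apply/andP; split; lra.
      by rewrite hc0 sub0r normrN hz ltxx.
    by split=> [/nk|/nk]; case; lra.
  have /cvgrPdist_lt/(_ `|h c|) := ch _ cab; rewrite normr_gt0 => /(_ hc0).
  rewrite -nbhs_nearE => /nbhs_ballP[eta /= eta0 H].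
  exists eta => // x y ax xc cy yb xe ye.
  suff -> : h x = h y by [].
  apply: abs_continuous_derive0_const; first lra.
    exact: abs_continuous_itvS ACh.
  move: dh; apply: ae_mono => z dh xz zy; apply: dh; [lra|lra|].
  have : ball c eta z by rewrite /ball/= ltr_norml; apply/andP; split; lra.
  by move=> /H/=; apply: contraTneq => ->; rewrite subr0 ltxx.
apply/eqP; apply: contrapT => /negP hab.
have [ha0|ha0] := eqVneq (h a) 0.
  have hb0 : h b != 0 by rewrite -ha0 eq_sym.
  apply: (@real_induction R (fun x => h x <> h b) a b) => //; first exact/eqP.
  move=> c cab; have [eta eta0 H] := loc _ hb0 _ cab.
  exists eta => // x y *; rewrite -(H x y)//.
move/eqP : hab; apply; apply/esym.
apply: (@real_induction R (fun x => h x = h a) a b) => //.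
move=> c cab; have [eta eta0 H] := loc _ ha0 _ cab.
by exists eta => // x y *; rewrite -(H x y).
Qed.

(** The quotient [omega * expR (- L)] has derivative zero at almost every point
  where it is nonzero. *)
Lemma linear_ode_solution (I : set R) (omega L l : R -> R) : is_interval I ->
    (forall x : R, I x -> is_derive x 1 L (l x)) ->
    (forall x, I x -> {for x, continuous l}) ->
    (forall x, I x -> {for x, continuous omega}) ->
    (forall a b, a < b -> I a -> I b -> abs_continuous_itv a b omega) ->
    (\forall x \ae mu, I x -> omega x != 0 -> is_derive x 1 omega (l x * omega x)) ->
  exists C : R, forall x, I x -> omega x = C * expR (L x).
Proof.
move=> itvI dL cl comega AComega domega.
have [[x0 Ix0]|nI] := pselect (exists x, I x); last first.
  by exists 0 => x Ix; case: nI; exists x.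
pose g x := expR (- L x); pose g' x := - l x * expR (- L x).
have dg x : I x -> is_derive x 1 g (g' x).
  move=> Ix; have dLx := dL _ Ix.
  rewrite /g' mulrC; apply: (@is_derive1_comp _ expR (fun x => - L x)).
have cL x : I x -> {for x, continuous L}.
  move=> Ix; apply: differentiable_continuous; apply/derivable1_diffP.
  by have [] := dL _ Ix.
have cg x : I x -> {for x, continuous g}.
  move=> Ix; apply: differentiable_continuous; apply/derivable1_diffP.
  by have [] := dg _ Ix.
have cg' x : I x -> {for x, continuous g'}.
  move=> Ix; apply: cvgM; last exact: cg.
  by apply: cvgN; exact: cl.
pose h x := omega x * g x.
have hE a b : a < b -> I a -> I b -> h a = h b.
  move=> ab Ia Ib.
  have Iab x : a <= x <= b -> I x by exact: itvI.
  apply: abs_continuous_locally_const; first exact: ltW.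
  - by move=> x /Iab Ix; apply: cvgM; [exact: comega|exact: cg].
  - have [M M0 HM] := continuous_bounded_itv a b omega (fun x xab => comega x (Iab x xab)).
    have [G G0 HG] := continuous_bounded_itv a b g (fun x xab => cg x (Iab x xab)).
    have [K K0 HK] := C1_lipschitz_itv a b g g' (fun x xab => dg x (Iab x xab))
      (fun x xab => cg' x (Iab x xab)).
    apply: abs_continuousM HM HG _ _; first exact: AComega.
    exact: abs_continuous_lipschitz HK.
  - move: domega; apply: ae_mono => x domega ax xb hx0.
    have Ix : I x by apply: Iab; lra.
    have o0 : omega x != 0.
      by apply: contra_neq hx0 => o0; rewrite /h o0 mul0r.
    have dom := domega Ix o0; have dgx := dg _ Ix.
    apply: is_derive_eq (is_deriveM dom dgx) _.
    by rewrite /g' /g /GRing.scale/=; ring.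
exists (h x0) => x Ix.
have -> : h x0 = h x.
  have [xx0|x0x|->//] := ltgtP x x0; first by rewrite (hE x x0).
  by rewrite (hE x0 x).
by rewrite /h /g -mulrA -expRD addNr expR0 mulr1.
Qed.

End LinearODE.

(** * Monotone absolutely continuous functions and iterated derivatives *)

Section DerivativeChains.
Context {R : realType}.
Local Notation mR := (measurableTypeR R).
Local Notation mu := (@lebesgue_measure R).
Implicit Types (f g w omega : R -> R).

(** Split each increment at [m].  Left of [m] the function is Lipschitz; right of
  [m] the images of non-overlapping intervals are non-overlapping subintervals
  of [[f b, f m]], an interval of small length. *)
Lemma abs_continuous_nonincreasing (a b : R) f :
    (forall x y, a <= x -> x <= y -> y <= b -> f y <= f x) ->
    (forall e, 0 < e -> exists m K : R, [/\ a <= m, m <= b, f m - f b < e &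
      forall x y, a <= x -> x <= y -> y <= m -> f x - f y <= K * (y - x)]) ->
  abs_continuous_itv a b f.
Proof.
move=> fdec fm e e0; have e20 : 0 < e / 2 by rewrite divr_gt0.
have [m [K [am mb fmb Klip]]] := fm _ e20.
have K0 : 0 < `|K| + 1 by rewrite ltr_wpDl.
exists (e / 2 / (`|K| + 1)); first by rewrite divr_gt0.
move=> l s t st dis; rewrite ltr_pdivlMr// => sumd.
pose s1 i := Num.min (s i) m; pose t1 i := Num.min (t i) m.
pose s2 i := Num.max (s i) m; pose t2 i := Num.max (t i) m.
have minmax (x : R) : f x = f (Num.min x m) + f (Num.max x m) - f m.
  by case: (leP x m) => _; ring.
have sum1 : \sum_(i < l) (f (s1 i) - f (t1 i)) <= e / 2.
  apply: le_trans (ltW sumd); rewrite mulr_suml; apply: ler_sum => i _.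
  have [asi sti tib] := st i.
  have st1 : s1 i <= t1 i.
    by rewrite /s1 /t1 le_min !ge_min sti lexx !orbT.
  have d1 : t1 i - s1 i <= t i - s i.
    by rewrite /s1 /t1; case: (leP (s i) m); case: (leP (t i) m); lra.
  rewrite (le_trans (Klip _ _ _ st1 _))//.
  - by rewrite /s1 le_min asi.
  - by rewrite /t1 ge_min lexx orbT.
  - have := ler_norm K; have := normr_ge0 K; nra.
have sum2 : \sum_(i < l) (f (s2 i) - f (t2 i)) <= f m - f b.
  have fbm : f b <= f m by exact: fdec.
  have bnd i : [/\ m <= s2 i, s2 i <= t2 i & t2 i <= b].
    have [asi sti tib] := st i; split.
    - by rewrite /s2 le_max lexx orbT.
    - by rewrite /s2 /t2 ge_max !le_max sti lexx !orbT.
    - by rewrite /t2 ge_max tib mb.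
  have U : (mu `]f b, f m[%classic = (f m - f b)%:E)%E.
    rewrite lebesgue_measure_itv/= lte_fin; case: ltP => // mfb.
    by rewrite (@le_anti _ _ (f b) (f m)) ?subrr// mfb fbm.
  rewrite -lee_fin -U; apply: (@sum_length_le R l (f \o t2) (f \o s2)).
  - exact: measurable_itv.
  - by move=> i /=; have [? ? ?] := bnd i; apply: fdec => //; lra.
  - move=> i x /=; rewrite !in_itv/= => /andP[fx xf].
    have [? ? ?] := bnd i.
    have : f b <= f (t2 i) by apply: fdec => //; lra.
    have : f (s2 i) <= f m by apply: fdec => //; lra.
    by move=> *; apply/andP; split; lra.
  - move=> i j ij /=.
    have [? ? ?] := bnd i; have [? ? ?] := bnd j.
    case: (dis i j ij) => h; [right|left]; apply: fdec; try lra;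
      by rewrite /s2 /t2 ge_max !le_max h lexx !orbT.
rewrite (_ : \sum_(i < l) _ = \sum_(i < l) ((f (s1 i) - f (t1 i)) + (f (s2 i) - f (t2 i)))).
  by rewrite big_split/=; lra.
apply: eq_bigr => i _; have [asi sti tib] := st i.
rewrite distrC ger0_norm ?subr_ge0; last exact: fdec.
by rewrite (minmax (s i)) (minmax (t i)) /s1 /s2 /t1 /t2; ring.
Qed.

Lemma is_derive_local (U : set R) f g (x d : R) : open U -> U x ->
  (forall y, U y -> f y = g y) -> is_derive x 1 g d -> is_derive x 1 f d.
Proof.
move=> oU Ux fg; apply: near_eq_is_derive.
have : nbhs x U by exact: open_nbhs_nbhs.
by apply: filterS => y Uy; rewrite fg.
Qed.

Lemma derive1n_chain omega (F : nat -> R -> R) m :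
    (forall x, 0 < x -> omega x = F 0%N x) ->
    (forall k, (k < m)%N -> forall x : R, 0 < x -> is_derive x 1 (F k) (F k.+1 x)) ->
  forall k, (k <= m)%N -> forall x, 0 < x -> derive1n k omega x = F k x.
Proof.
move=> F0 FS; elim=> [_ x x0|k IH km x x0]; first exact: F0.
rewrite derive1nS derive1E; apply: derive_val.
apply: (@is_derive_local Rpos _ (F k)).
- exact: interval_open.
- by rewrite /Rpos/= in_itv/= x0.
- by move=> y; rewrite /Rpos/= in_itv/= andbT => y0; apply: IH => //; exact: ltnW.
- exact: FS.
Qed.

(** Reduces the regularity of [omega] to explicit formulas for its derivatives
  that hold on the open half-line only, where derivatives are local. *)
Lemma C_pos_chain omega (F : nat -> R -> R) m :
    (forall x, 0 < x -> omega x = F 0%N x) ->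
    (forall k, (k < m)%N -> forall x : R, 0 < x -> is_derive x 1 (F k) (F k.+1 x)) ->
    (forall x, 0 < x -> {for x, continuous (F m)}) ->
    loc_abs_continuous_pos (F m) ->
  C_pos m omega /\ loc_abs_continuous_pos (derive1n m omega).
Proof.
move=> F0 FS cF acF; have Fk := derive1n_chain _ _ _ F0 FS.
have oR : open (Rpos : set R) by exact: interval_open.
split; first split.
- move=> k km x x0; have [+ _] := FS _ km _ x0.
  apply: near_eq_derivable.
  have : nbhs x (Rpos : set R).
    by apply: open_nbhs_nbhs; split=> //; rewrite /Rpos/= in_itv/= x0.
  apply: filterS => y; rewrite /Rpos/= in_itv/= andbT => y0.
  by rewrite Fk// ltnW.
- move=> x x0; have := cF _ x0; rewrite /prop_for /continuous_at Fk//.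
  apply: cvg_trans; apply: near_eq_cvg.
  have : nbhs x (Rpos : set R).
    by apply: open_nbhs_nbhs; split=> //; rewrite /Rpos/= in_itv/= x0.
  apply: filterS => y; rewrite /Rpos/= in_itv/= andbT => y0.
  by rewrite Fk.
- move=> a b a0 ab e /(acF a b a0 ab)[d d0 H]; exists d => // l s t st dis /(H _ _ _ st dis).
  congr (_ < _); apply: eq_bigr => i _; have [? ? ?] := st i.
  by rewrite !Fk//; lra.
Qed.

(** As for [C_pos_chain], but on an open set [U] that may avoid the singular
  points: values off [U] do not influence Euler derivatives on [U]. *)
Lemma euler_chain omega (U : set R) (G : nat -> R -> R) : open U -> U `<=` Rpos ->
    (forall x, U x -> omega x = G 0%N x) ->
    (forall k (x : R), U x -> is_derive x 1 (G k) (G k.+1 x / x)) ->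
  forall k x, U x -> iter k euler omega x = G k x.
Proof.
move=> oU Upos G0 GS; elim=> [|k IH] x Ux; first exact: G0.
have x0 : 0 < x by have := Upos _ Ux; rewrite /Rpos/= in_itv/= andbT.
rewrite iterS /euler derive1E.
have -> : 'D_1 (iter k euler omega) x = G k.+1 x / x.
  apply: derive_val; apply: (is_derive_local U _ (G k)) => //; exact: GS.
by rewrite mulrC divfK// gt_eqF.
Qed.

End DerivativeChains.

(** * Obstructions to integrability *)

Section Integrability.
Context {R : realType}.
Local Notation mR := (measurableTypeR R).
Local Notation mu := (@lebesgue_measure R).
Implicit Types (f g w : R -> R).

(** If [|f|] dominates [G'], the increments of [G] are bounded by the integral of
  [|f|]: an unbounded primitive of a minorant of [|f|] contradicts the
  integrability of [f]. *)
Lemma primitive_bounded (D : set R) f (G g : R -> R) : measurable D ->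
    mu.-integrable D (EFin \o f) ->
  exists M : R, forall a b : R, a < b -> `[a, b]%classic `<=` D ->
    (forall x : R, a <= x <= b -> is_derive x 1 G (g x)) ->
    (forall x, a <= x <= b -> {for x, continuous g}) ->
    (forall x, a <= x <= b -> 0 <= g x) ->
    (\forall x \ae mu, a <= x <= b -> g x <= `|f x|) ->
    G b - G a <= M.
Proof.
move=> mD /integrableP[mf fi]; exists (fine (\int[mu]_(x in D) `|(f x)%:E|)).
move=> a b ab abD dG cg g0 gf.
have mabD : measurable (`[a, b]%classic : set mR) by exact: measurable_itv.
have cG x : a <= x <= b -> {for x, continuous G}.
  move=> xab; apply: differentiable_continuous; apply/derivable1_diffP.
  by have [] := dG _ xab.
have cgab : {within `[a, b], continuous g}.
  by apply: continuous_in_subspaceT => x; rewrite inE/= in_itv/=; exact: cg.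
have E : (\int[mu]_(x in `[a, b]) (g x)%:E)%E = ((G b)%:E - (G a)%:E)%E.
apply: continuous_FTC2 => //.
- split.
  + move=> x; rewrite in_itv/= => /andP[ax xb].
    by have [|] := dG x _; rewrite ?ltW.
  + by apply: cvg_at_right_filter; apply: cG; rewrite lexx ltW.
  + by apply: cvg_at_left_filter; apply: cG; rewrite lexx ltW.
- move=> x; rewrite in_itv/= => /andP[ax xb].
  by rewrite derive1E; apply: derive_val; apply: dG; rewrite !ltW.
rewrite -lee_fin EFinB -E fineK; last first.
  by rewrite ge0_fin_numE// integral_ge0.
have mabsf : measurable_fun D (fun x => `|(f x)%:E|)%E by exact: measurableT_comp.
apply: (@le_trans _ _ (\int[mu]_(x in `[a, b]) `|(f x)%:E|)%E); last first.
  exact: ge0_subset_integral.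
apply: ae_ge0_le_integral => //.
- apply/measurable_EFinP; exact: subspace_continuous_measurable_fun.
- exact: measurable_funS mabsf.
Qed.


(** The primitive [c x] is unbounded at infinity. *)
Lemma not_all_moments w (c x0 : R) (m : nat) : 0 < x0 -> 0 < c ->
    mu.-integrable (Rpos : set R) (EFin \o (fun x => w x * x ^+ m)) ->
  ~ (\forall x \ae mu, x0 < x -> c <= `|w x * x ^+ m|).
Proof.
move=> x00 c0 iw lw.
have [M HM] := primitive_bounded _ _ (fun x => c * x) (fun=> c) (measurable_itv _) iw.
pose b := x0 + 1 + (`|M| + 1) / c.
have Mc : 0 < (`|M| + 1) / c by rewrite divr_gt0// ltr_wpDl.
have : c * b - c * (x0 + 1) <= M.
  apply: HM; first by rewrite /b; lra.
  - by move=> x /=; rewrite !in_itv/= andbT => /andP[? _]; lra.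
  - move=> x _; apply: is_derive_eq (is_deriveZ c (is_derive_id x 1)) _.
    exact: mulr1.
  - by move=> x _; exact: cvg_cst.
  - by move=> x _; exact: ltW.
  - move: lw; apply: ae_mono => x H /andP[? _].
    by apply: H; lra.
rewrite -mulrBr /b [_ - _](_ : _ = (`|M| + 1) / c); last by ring.
by rewrite mulrC divfK ?gt_eqF//; have := ler_norm M; lra.
Qed.

(** The primitive [c ln x] is unbounded at [0]. *)
Lemma not_integrable_inv0 w (c d : R) : 0 < d -> 0 < c ->
    mu.-integrable (Rpos : set R) (EFin \o w) ->
  ~ (\forall x \ae mu, 0 < x < d -> c / x <= `|w x|).
Proof.
move=> d0 c0 iw lw.
have [M HM] := primitive_bounded _ _ (fun x => c * ln x) (fun x => c * x^-1) (measurable_itv _) iw.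
pose b := d / 2; pose a := b * expR (- ((`|M| + 1) / c)).
have b0 : 0 < b by rewrite divr_gt0.
have a0 : 0 < a by rewrite mulr_gt0// expR_gt0.
have ab : a < b.
  by rewrite /a gtr_pMr// expR_lt1 oppr_lt0 divr_gt0// ltr_wpDl.
have : c * ln b - c * ln a <= M.
  apply: HM => //.
  - by move=> x /=; rewrite !in_itv/= andbT => /andP[? _]; lra.
  - move=> x /andP[ax xb]; have x0 : 0 < x by lra.
    exact: is_deriveZ (is_derive1_ln x0).
  - move=> x /andP[ax xb]; have x0 : x != 0 by rewrite gt_eqF//; lra.
    by apply: cvgM; [exact: cvg_cst | exact: cvgV].
  - by move=> x /andP[ax xb]; rewrite divr_ge0//; lra.
  - move: lw; apply: ae_mono => x H /andP[? xb].
    by apply: H; rewrite /b in xb; lra.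
rewrite /a lnM ?posrE ?expR_gt0// expRK -mulrBr opprD opprK addNKr.
by rewrite mulrC divfK ?gt_eqF//; have := ler_norm M; lra.
Qed.

(** The primitive [- c ln (r - x)] is unbounded at [r]. *)
Lemma not_integrable_inv_left w (c d r : R) : 0 < r -> 0 < d -> 0 < c ->
    mu.-integrable (Rpos : set R) (EFin \o w) ->
  ~ (\forall x \ae mu, 0 < x -> r - d < x < r -> c / (r - x) <= `|w x|).
Proof.
move=> r0 d0 c0 iw lw.
have [M HM] := primitive_bounded _ _ (fun x => - c * ln (r - x))
  (fun x => c * (r - x)^-1) (measurable_itv _) iw.
pose m := Num.min d r / 2.
have m0 : 0 < m by rewrite divr_gt0// lt_min d0.
have md : m < d.
  have : Num.min d r <= d by rewrite ge_min lexx.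
  by rewrite /m; lra.
have mr : m < r.
  have : Num.min d r <= r by rewrite ge_min lexx orbT.
  by rewrite /m; lra.
pose e := m * expR (- ((`|M| + 1) / c)).
have e0 : 0 < e by rewrite mulr_gt0// expR_gt0.
have em : e < m.
  by rewrite /e gtr_pMr// expR_lt1 oppr_lt0 divr_gt0// ltr_wpDl.
have : - c * ln (r - (r - e)) - (- c * ln (r - (r - m))) <= M.
  apply: HM; first lra.
  - by move=> x /=; rewrite !in_itv/= andbT => /andP[? _]; lra.
  - move=> x /andP[ax xb]; have x0 : 0 < r - x by lra.
    have drx : is_derive x 1 (fun x => r - x) (- 1 : R).
      apply: is_derive_eq (is_deriveB (is_derive_cst r x 1) (is_derive_id x 1)) _.
      by rewrite sub0r.
    have dl : is_derive x 1 (fun x => ln (r - x)) ((r - x)^-1 * -1).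
      exact: (@is_derive1_comp _ (@ln R) (fun x => r - x) _ _ _ (is_derive1_ln x0) drx).
    apply: is_derive_eq (is_deriveZ (- c) dl) _.
    by rewrite /GRing.scale/=; ring.
  - move=> x /andP[ax xb]; have x0 : r - x != 0 by rewrite gt_eqF//; lra.
    apply: cvgM; first exact: cvg_cst.
    by apply: cvgV => //; apply: cvgB; [exact: cvg_cst | exact: cvg_id].
  - by move=> x /andP[ax xb]; rewrite divr_ge0//; lra.
  - move: lw; apply: ae_mono => x H /andP[? xb].
    by apply: H; lra.
rewrite !subKr /e lnM ?posrE ?expR_gt0// expRK.
rewrite (_ : _ - _ = c * ((`|M| + 1) / c)); last by ring.
by rewrite mulrC divfK ?gt_eqF//; have := ler_norm M; lra.
Qed.

End Integrability.

(** * Solutions of the first order equation and their moments *)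

Section LogPotential.
Context {R : realType}.
Local Notation mR := (measurableTypeR R).
Local Notation mu := (@lebesgue_measure R).
Implicit Types (f g w omega : R -> R).

(** The derivative is the limit of a filter, which is [0] by convention when it
  does not exist. *)
Lemma derive1_not_derivable f (x : R) : ~ derivable f x 1 -> derive1 f x = 0.
Proof. by move=> df; rewrite derive1E; apply: dvgP. Qed.

Lemma ae_affine_neq0 (a b : R) : (a != 0) || (b != 0) ->
  \forall x \ae mu, a + b * x != 0.
Proof.
move=> ab; exists [set - a / b]; split.
- exact: measurable_set1.
- exact: lebesgue_measure_set1.
move=> x /= /negP; rewrite negbK => /eqP abx; move: ab.
have [b0|b0 _] := eqVneq b 0.
  by rewrite orbF -abx b0 mul0r addr0 eqxx.
apply/eqP; rewrite eq_sym -subr_eq0; apply/eqP.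
have -> : a = - (b * x) by lra.
by field.
Qed.

(** A primitive of [A / x + B / (x - r) + D / x ^ 2 + k] on the side of [r] where
  [s * (x - r) > 0]; the term [expR (- ln x)] is [1 / x]. *)
Definition log_potential (A B D k r s x : R) : R :=
  A * ln x + B * ln (s * (x - r)) - D * expR (- ln x) + k * x.

Lemma is_derive_log_potential (A B D k r s x : R) : 0 < x -> 0 < s * (x - r) ->
  is_derive x 1 (log_potential A B D k r s) (A / x + B / (x - r) + D / x ^+ 2 + k).
Proof.
move=> x0 sx0.
have d1 := is_deriveZ A (is_derive1_ln x0).
have dsx : is_derive x 1 (fun x => s * (x - r)) s.
  apply: is_derive_eq (is_deriveZ s (is_deriveB (is_derive_id x 1) (is_derive_cst r x 1))) _.
  by rewrite subr0; exact: mulr1.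
have d2 : is_derive x 1 (fun x => ln (s * (x - r))) ((s * (x - r))^-1 * s).
  exact: (@is_derive1_comp _ (@ln R) (fun x => s * (x - r)) _ _ _ (is_derive1_ln sx0) dsx).
have d3 : is_derive x 1 (fun x => expR (- ln x)) (expR (- ln x) * - x^-1).
  exact: (@is_derive1_comp _ (@expR R) (fun x => - ln x) _ _ _
    (is_derive_expR _) (is_deriveN (is_derive1_ln x0))).
have d4 := is_deriveZ k (is_derive_id x 1).
apply: is_derive_eq (is_deriveD (is_deriveB (is_deriveD d1 (is_deriveZ B d2)) (is_deriveZ D d3)) d4) _.
rewrite /GRing.scale/= expRN lnK ?posrE//; field.
have s0 : s != 0 by apply: contraTneq sx0 => ->; rewrite mul0r ltxx.
have xr0 : x - r != 0 by apply: contraTneq sx0 => ->; rewrite mulr0 ltxx.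
by rewrite (gt_eqF x0) s0 xr0.
Qed.

Lemma continuous_log_potential_slope (A B D k r x : R) : 0 < x -> x != r ->
  {for x, continuous (fun x : R => A / x + B / (x - r) + D / x ^+ 2 + k)}.
Proof.
move=> x0 xr; have xr0 : x - r != 0 by rewrite subr_eq0.
have x0' : x != 0 by rewrite gt_eqF.
apply: cvgD; last exact: cvg_cst.
apply: cvgD; first apply: cvgD.
- by apply: cvgM; [exact: cvg_cst | exact: cvgV].
- apply: cvgM; first exact: cvg_cst.
  by apply: cvgV => //; apply: cvgB; [exact: cvg_id | exact: cvg_cst].
- apply: cvgM; first exact: cvg_cst.
  by apply: cvgV; [rewrite expf_neq0 | exact: exprn_continuous].
Qed.

(** For large [x] all logarithms in the potential are at most [ln x + ln 2] in
  absolute value, so in absolute value the right-hand side is at least a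
  constant times [C x^(- m)] with [m >= |A| + |B|], and the moment of order [m + 1] of [w]
  would be infinite if [C] were nonzero. *)
Lemma tail_moments_eq0 w (A B D k r P0 P1 C l : R) : 0 <= k -> 0 <= l ->
    (forall m, mu.-integrable (Rpos : set R) (EFin \o (fun x => w x * x ^+ m))) ->
    (\forall x \ae mu, l < x -> r < x ->
      (P0 + P1 * x) * w x = C * expR (log_potential A B D k r 1 x)) ->
  C = 0.
Proof.
move=> k0 l0 iw wE; apply/eqP; apply: contraT => C0.
(* E collects the terms of the potential that stay bounded. *)
pose m := Num.bound (`|A| + `|B|); pose E := `|B| * ln 2 + `|D|.
pose K := `|P0| + `|P1| + 1.
have K0 : 0 < K by rewrite /K ltr_wpDl// addr_ge0.
have [] := @not_all_moments R w (`|C| * expR (- E) / K) (l + 2 * `|r| + 1) m.+1 _ _ (iw _).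
- by rewrite ltr_wpDl// addr_ge0// mulr_ge0.
- by rewrite divr_gt0// mulr_gt0 ?expR_gt0// normr_gt0.
move: wE; apply: ae_mono => x H lx.
have r1 : r <= `|r| := ler_norm r.
have r2 : - `|r| <= r by have := ler_norm (- r); rewrite normrN; lra.
have r3 : 0 <= `|r| by [].
have x1 : 1 < x by lra.
have x0 : 0 < x by lra.
have {}H : (P0 + P1 * x) * w x = C * expR (log_potential A B D k r 1 x) by apply: H; lra.
have lnx0 : 0 <= ln x by rewrite ln_ge0// ltW.
have ln20 : 0 <= ln 2 :> R by rewrite ln_ge0//; lra.
have xr0 : 0 < x - r by lra.
have lnxr : `|ln (x - r)| <= ln x + ln 2.
  rewrite ler_norml; apply/andP; split.
    rewrite -lerN2 opprK -lnV ?posrE//.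
    rewrite -lnM ?posrE// ler_ln ?posrE ?invr_gt0 ?mulr_gt0//.
    rewrite -div1r ler_pdivrMr//; nra.
  by rewrite -lnM ?posrE// ler_ln ?posrE ?mulr_gt0//; lra.
have LE : - (E + m%:R * ln x) <= log_potential A B D k r 1 x.
  rewrite /log_potential mul1r.
  have e1 : - (`|A| * ln x) <= A * ln x.
    by rewrite -mulNr ler_wpM2r//; have := ler_norm (- A); rewrite normrN; lra.
  have e2 : - (`|B| * (ln x + ln 2)) <= B * ln (x - r).
    have := ler_norm (- (B * ln (x - r))); rewrite normrN normrM => h.
    have : `|B| * `|ln (x - r)| <= `|B| * (ln x + ln 2) by rewrite ler_wpM2l.
    lra.
  have e3 : D * expR (- ln x) <= `|D|.
    have : expR (- ln x) <= 1 by rewrite expR_le1; lra.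
    have := expR_ge0 (- ln x); have := ler_norm D; have := normr_ge0 D; nra.
  have e4 : 0 <= k * x by rewrite mulr_ge0// ltW.
  have e5 : (`|A| + `|B|) * ln x <= m%:R * ln x.
    by rewrite ler_wpM2r// ltW// archi_boundP// addr_ge0.
  rewrite /E; lra.
have xm : expR (m%:R * ln x) = x ^+ m by rewrite expRM_natl lnK ?posrE.
have Pb : `|P0 + P1 * x| <= K * x.
  rewrite (le_trans (ler_normD _ _))// normrM (gtr0_norm x0) /K.
  have := normr_ge0 P0; have := normr_ge0 P1; nra.
rewrite ler_pdivrMr// exprSr mulrA normrM (gtr0_norm x0) normrM.
have xm0 : 0 < x ^+ m by rewrite exprn_gt0.
rewrite (gtr0_norm xm0).
have : `|C| * expR (- E) <= `|C| * expR (log_potential A B D k r 1 x) * x ^+ m.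
  rewrite -mulrA ler_wpM2l// -xm -expRD ler_expR.
  lra.
move=> /le_trans; apply.
have -> : `|C| * expR (log_potential A B D k r 1 x) = `|P0 + P1 * x| * `|w x|.
  by rewrite -normrM H normrM [X in _ = _ * X]ger0_norm// expR_ge0.
rewrite [leRHS](_ : _ = K * x * (`|w x| * x ^+ m)); last by ring.
by rewrite -mulrA ler_wpM2r// mulr_ge0// ltW.
Qed.


Lemma powR_lower_bound (p u v : R) : 0 < u -> u <= v ->
  exists2 c : R, 0 < c & forall y, u <= y <= v -> c <= y `^ p.
Proof.
move=> u0 uv; exists (expR (- (`|p| * (`|ln u| + `|ln v|)))); first exact: expR_gt0.
move=> y /andP[uy yv]; have y0 : 0 < y by lra.
rewrite /powR gt_eqF// ler_expR.
have lny : `|ln y| <= `|ln u| + `|ln v|.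
  have h1 : ln u <= ln y by rewrite ler_ln ?posrE.
  have h2 : ln y <= ln v by rewrite ler_ln ?posrE//; lra.
  rewrite ler_norml; have := ler_norm (- ln u); have := ler_norm (ln v).
  have := normr_ge0 (ln u); have := normr_ge0 (ln v); rewrite normrN.
  by move=> *; apply/andP; split; lra.
have := ler_norm (- (p * ln y)); rewrite normrN normrM => h.
have : `|p| * `|ln y| <= `|p| * (`|ln u| + `|ln v|) by rewrite ler_wpM2l.
lra.
Qed.

Lemma powR_ge_inv (p x : R) : p <= -1 -> 0 < x -> x <= 1 -> x^-1 <= x `^ p.
Proof.
by move=> p1 x0 x1; rewrite -(powR_inv1 (ltW x0)); apply: ger_powR => //; rewrite x0.
Qed.

Lemma exponent_at_0 w (c d A : R) : 0 < c -> 0 < d ->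
    mu.-integrable (Rpos : set R) (EFin \o w) ->
    (\forall x \ae mu, 0 < x < d -> c * x `^ A <= `|w x|) -> -1 < A.
Proof.
move=> c0 d0 iw lw; rewrite ltNge; apply/negP => A1.
apply: (@not_integrable_inv0 R w c (Num.min d 1)) => //.
  by rewrite lt_min d0/=.
move: lw; apply: ae_mono => x H.
rewrite lt_min => /andP[x0 /andP[xd x1]].
rewrite (le_trans _ (H _)) ?x0// ler_pM2l// powR_ge_inv//; exact: ltW.
Qed.

Lemma exponent_at_r w (c d r p : R) : 0 < c -> 0 < d -> 0 < r ->
    mu.-integrable (Rpos : set R) (EFin \o w) ->
    (\forall x \ae mu, 0 < x -> r - d < x < r -> c * (r - x) `^ p <= `|w x|) ->
  -1 < p.
Proof.
move=> c0 d0 r0 iw lw; rewrite ltNge; apply/negP => p1.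
apply: (@not_integrable_inv_left R w c (Num.min d 1) r) => //.
  by rewrite lt_min d0/=.
move: lw; apply: ae_mono => x H x0.
have h1 : Num.min d 1 <= d by rewrite ge_min lexx.
have h2 : Num.min d 1 <= 1 by rewrite ge_min lexx orbT.
move=> /andP[rx xr].
rewrite (le_trans _ (H _ _))//; last by apply/andP; split; lra.
rewrite ler_pM2l// powR_ge_inv//; lra.
Qed.

Lemma ae_span_mem n (v : 'I_n -> R -> R) i : ae_span v (v i).
Proof.
exists (fun j => (j == i)%:R); apply: aeW => x _.
by rewrite (bigD1 i)//= eqxx mul1r big1 ?addr0// => j /negPf ->; rewrite mul0r.
Qed.

(** The two inclusions of the equality of spans, applied to the generators. *)
Lemma OPE2_relations w omega :
    mult_derivative_type_wrt (@OPE_fun R 2 (ext0 Rpos w)) omega ->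
  exists p0 p1 q0 q1 e0 e1 f0 f1 : R,
  \forall x \ae mu, 0 < x -> [/\
    omega x = (p0 + p1 * x) * w x,
    euler omega x = (q0 + q1 * x) * w x,
    w x = e0 * omega x + e1 * euler omega x &
    x * w x = f0 * omega x + f1 * euler omega x].
Proof.
move=> [_ spanE].
have W (x : R) : 0 < x -> ext0 Rpos w x = w x.
  by move=> x0; rewrite /ext0 patchE mem_set// /Rpos/= in_itv/= x0.
have [a Ha] : ae_span (@OPE_fun R 2 (ext0 Rpos w)) omega.
  by rewrite spanE; exact: (ae_span_mem 2 (fun j : 'I_2 => iter j euler omega) ord0).
have [b Hb] : ae_span (@OPE_fun R 2 (ext0 Rpos w)) (euler omega).
  by rewrite spanE; exact: (ae_span_mem 2 (fun j : 'I_2 => iter j euler omega) 1).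
have [c Hc] : ae_span (fun j : 'I_2 => iter j euler omega) (@OPE_fun R 2 (ext0 Rpos w) ord0).
  by rewrite -spanE; exact: ae_span_mem.
have [d Hd] : ae_span (fun j : 'I_2 => iter j euler omega) (@OPE_fun R 2 (ext0 Rpos w) 1).
  by rewrite -spanE; exact: ae_span_mem.
exists (a ord0), (a (lift ord0 ord0)), (b ord0), (b (lift ord0 ord0)).
exists (c ord0), (c (lift ord0 ord0)), (d ord0), (d (lift ord0 ord0)).
move: (ae_and (ae_and Ha Hb) (ae_and Hc Hd)).
apply: ae_mono => x /= [[{}Ha {}Hb] [{}Hc {}Hd]] x0.
have xpos : Rpos x by rewrite /Rpos/= in_itv/= x0.
move: (Ha xpos) (Hb xpos) (Hc xpos) (Hd xpos).
rewrite !big_ord_recl !big_ord0 /OPE_fun /= !W// !addr0 !expr0 !expr1 !mul1r.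
move=> e1 e2 e3 e4; split; [rewrite e1|rewrite e2|exact: e3|exact: e4]; ring.
Qed.

End LogPotential.

(** * Weights of derivative type for n = 2 *)

Section OrderTwo.
Context {R : realType}.
Local Notation mR := (measurableTypeR R).
Local Notation mu := (@lebesgue_measure R).
Implicit Types (f g w omega : R -> R).

(** If [w = e u] and [x w = f u] then [(f - e x) w = 0], and an affine function
  vanishes at one point at most unless [e = f = 0], when [w = e u = 0].  For
  [n = 2] this rules out [p = 0] and [q = 0]. *)
Lemma proportional_ae0 w u (e f : R) :
    (\forall x \ae mu, 0 < x -> w x = e * u x /\ x * w x = f * u x) ->
  \forall x \ae mu, 0 < x -> w x = 0.
Proof.
move=> H; have [ef|] := boolP ((f != 0) || (- e != 0)); last first.
  rewrite negb_or !negbK oppr_eq0 => /andP[/eqP f0 /eqP e0].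
  by move: H; apply: ae_mono => x H /H[-> _]; rewrite e0 mul0r.
move: (ae_and H (ae_affine_neq0 _ _ ef)).
apply: ae_mono => x [{}H fe0] /H[h1 h2].
apply/eqP; move: fe0; apply: contraNT => w0.
have : (f - e * x) * w x = 0.
  by rewrite mulrBl -[e * x * _]mulrA h2 [in X in X - _]h1; ring.
by move/eqP; rewrite mulf_eq0 (negPf w0) orbF mulNr.
Qed.

(** Where [omega] is not derivable, its derivative is [0] by convention, so
  [q w = 0] and, off the root of [q], [w] and [omega = p w] vanish.  Hence
  [omega] is derivable at almost every point where it is nonzero. *)
Lemma omega_ode w omega (p0 p1 q0 q1 : R) : (q0 != 0) || (q1 != 0) ->
    (\forall x \ae mu, 0 < x -> omega x = (p0 + p1 * x) * w x) ->
    (\forall x \ae mu, 0 < x -> euler omega x = (q0 + q1 * x) * w x) ->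
  \forall x \ae mu, 0 < x -> omega x != 0 -> p0 + p1 * x != 0 /\
    is_derive x 1 omega ((q0 + q1 * x) / (x * (p0 + p1 * x)) * omega x).
Proof.
move=> q_neq0 Hp Hq.
move: (ae_and (ae_and Hp Hq) (ae_affine_neq0 _ _ q_neq0)).
apply: ae_mono => x [[{}Hp {}Hq] qx0] x0 ox0.
move: (Hp x0) (Hq x0) => oE eE.
have px0 : p0 + p1 * x != 0 by apply: contra_neq ox0 => px0; rewrite oE px0 mul0r.
split=> //.
have dx : derivable omega x 1.
  apply: contrapT => /derive1_not_derivable dx.
  move: eE; rewrite /euler dx mulr0 => /esym/eqP.
  rewrite mulf_eq0 (negPf qx0)/= => /eqP w0.
  by move: ox0; rewrite oE w0 mulr0 eqxx.
apply: DeriveDef => //; rewrite -derive1E.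
have -> : derive1 omega x = x^-1 * ((q0 + q1 * x) * w x).
  by rewrite -eE /euler mulKf// gt_eqF.
by rewrite oE; field; rewrite px0 gt_eqF.
Qed.

(** [linear_ode_solution] on one side of [r]; the sign [s] of [x - r] selects the
  branch of the logarithm. *)
Lemma omega_solution w omega (p0 p1 q0 q1 A B D k r s : R) (I : set R) :
    is_interval I -> (q0 != 0) || (q1 != 0) ->
    (\forall x \ae mu, 0 < x -> omega x = (p0 + p1 * x) * w x) ->
    (\forall x \ae mu, 0 < x -> euler omega x = (q0 + q1 * x) * w x) ->
    (forall x, 0 < x -> {for x, continuous omega}) ->
    loc_abs_continuous_pos omega ->
    (forall x, I x -> 0 < x /\ 0 < s * (x - r)) ->
    (forall x, I x -> p0 + p1 * x != 0 -> (q0 + q1 * x) / (x * (p0 + p1 * x)) =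
      A / x + B / (x - r) + D / x ^+ 2 + k) ->
  exists C : R, forall x, I x -> omega x = C * expR (log_potential A B D k r s x).
Proof.
move=> itvI q_neq0 Hp Hq co ACo Ipos partial_frac.
apply: (@linear_ode_solution R I omega (log_potential A B D k r s)
  (fun x => A / x + B / (x - r) + D / x ^+ 2 + k)) => //.
- by move=> x /Ipos[x0 sx0]; exact: is_derive_log_potential.
- move=> x /Ipos[x0 sx0]; apply: continuous_log_potential_slope => //.
  by apply: contraTneq sx0 => ->; rewrite subrr mulr0 ltxx.
- by move=> x /Ipos[x0 _]; exact: co.
- by move=> a b ab /Ipos[a0 _] Ib; exact: ACo.
- move: (omega_ode w omega p0 p1 q0 q1 q_neq0 Hp Hq).
  apply: ae_mono => x H Ix ox0; have [x0 _] := Ipos _ Ix.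
  by have [px0] := H x0 ox0; rewrite partial_frac.
Qed.

(** A double pole at [0] occurs only when [p] vanishes at [0]. *)
Lemma partial_fractions (p1 q0 q1 r : R) : p1 != 0 -> exists A B D : R,
  (r != 0 -> D = 0) /\ forall x, 0 < x -> x - r != 0 ->
    (q0 + q1 * x) / (x * (p1 * (x - r))) = A / x + B / (x - r) + D / x ^+ 2 + 0.
Proof.
move=> p10; have [->|r0] := eqVneq r 0.
  exists (q1 / p1), 0, (q0 / p1); split=> //.
  move=> x x0 _; have x0' : x != 0 by rewrite gt_eqF.
  by rewrite subr0; field; rewrite p10 x0'.
exists (- q0 / (p1 * r)), ((q0 + q1 * r) / (p1 * r)), 0; split=> //.
move=> x x0 xr; have x0' : x != 0 by rewrite gt_eqF.
by field; rewrite p10 x0' r0 xr.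
Qed.


Lemma gamma_weight_solution w (p0 A k C : R) : p0 != 0 ->
    (forall m, mu.-integrable (Rpos : set R) (EFin \o (fun x => w x * x ^+ m))) ->
    ~ (\forall x \ae mu, 0 < x -> w x = 0) ->
    (\forall x \ae mu, 0 < x -> p0 * w x = C * expR (log_potential A 0 0 k (-1) 1 x)) ->
  [/\ k < 0, -1 < A & \forall x \ae mu, 0 < x -> w x = C / p0 * (x `^ A * expR (k * x))].
Proof.
move=> p00 iw wnz H.
have wE : \forall x \ae mu, 0 < x -> w x = C / p0 * (x `^ A * expR (k * x)).
  move: H; apply: ae_mono => x H x0; move: (H x0).
  rewrite /log_potential !mul0r subr0 addr0 expRD /powR (gt_eqF x0) => pw.
  by rewrite mulrAC -pw mulrAC mulfV// mul1r.
have C0 : C != 0.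
  apply/eqP => C0; apply: wnz; move: wE; apply: ae_mono => x {}H x0.
  by rewrite H// C0 !mul0r.
have iw0 : mu.-integrable (Rpos : set R) (EFin \o w).
  by have := iw 0%N; congr (integrable _ _ _); apply/funext => x; rewrite /= expr0 mulr1.
split=> //.
- rewrite ltNge; apply/negP => k0; move/eqP : C0; apply.
  apply: (tail_moments_eq0 w A 0 0 k (-1) p0 0 C 0) => //.
  by move: H; apply: ae_mono => x H x0 _; rewrite mul0r addr0 H.
- apply: (exponent_at_0 w (`|C / p0| * expR (- `|k|)) 1) => //.
    by rewrite mulr_gt0 ?expR_gt0// normr_gt0 mulf_neq0// invr_neq0.
  move: wE; apply: ae_mono => x {}H /andP[x0 x1].
  rewrite H// [in leRHS]normrM [X in _ <= _ * X]ger0_norm ?mulr_ge0 ?powR_ge0 ?expR_ge0//.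
  rewrite -mulrA ler_wpM2l// mulrC ler_wpM2l ?powR_ge0// ler_expR.
  by have := ler_norm (- k); have := normr_ge0 k; rewrite normrN; nra.
Qed.

Lemma beta_weight_solution w (p1 r A B C : R) : p1 != 0 -> 0 < r ->
    (forall m, mu.-integrable (Rpos : set R) (EFin \o (fun x => w x * x ^+ m))) ->
    ~ (\forall x \ae mu, 0 < x -> w x = 0) ->
    (\forall x \ae mu, 0 < x -> x < r ->
      p1 * (x - r) * w x = C * expR (log_potential A B 0 0 r (-1) x)) ->
    (\forall x \ae mu, r < x -> w x = 0) ->
  [/\ C != 0, -1 < A, -1 < B - 1 & \forall x \ae mu, 0 < x ->
    w x = - C / p1 * (if x < r then x `^ A * (r - x) `^ (B - 1) else 0)].
Proof.
move=> p10 r0 iw wnz H Hr.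
have wE : \forall x \ae mu, 0 < x ->
    w x = - C / p1 * (if x < r then x `^ A * (r - x) `^ (B - 1) else 0).
  have ae_r : \forall x \ae mu, - r + 1 * x != 0.
    by apply: ae_affine_neq0; rewrite oner_neq0 orbT.
  move: (ae_and (ae_and H Hr) ae_r).
  apply: ae_mono => x [[{}H {}Hr] xr] x0.
  case: ltP => [xltr|rx]; last first.
    by rewrite mulr0 Hr// lt_neqAle rx andbT; apply: contraNneq xr => ->; rewrite mul1r addNr.
  have := H x0 xltr; rewrite /log_potential mulN1r opprB !mul0r subr0 addr0 => pw.
  have rx0 : 0 < r - x by lra.
  rewrite /powR (gt_eqF x0) (gt_eqF rx0) -expRD mulrBl mul1r addrA expRB lnK ?posrE//.
  have px : p1 * (x - r) != 0 by rewrite mulf_neq0// lt_eqF//; lra.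
  by apply: (mulfI px); rewrite pw; field; rewrite p10 gt_eqF.
have C0 : C != 0.
  apply/eqP => C0; apply: wnz; move: wE; apply: ae_mono => x {}H x0.
  by rewrite H// C0 oppr0 !mul0r.
have iw0 : mu.-integrable (Rpos : set R) (EFin \o w).
  by have := iw 0%N; congr (integrable _ _ _); apply/funext => x; rewrite /= expr0 mulr1.
have c0 : 0 < `|- C / p1| by rewrite normr_gt0 mulf_neq0 ?oppr_eq0// invr_neq0.
split=> //.
- have [||c' c'0 Hc'] := powR_lower_bound (B - 1) (r / 2) r _ _; [lra|lra|].
  apply: (exponent_at_0 w (`|- C / p1| * c') (r / 2)) => //.
  + by rewrite mulr_gt0.
  + by rewrite divr_gt0.
  move: wE; apply: ae_mono => x {}H /andP[x0 xr].
  rewrite H// (_ : x < r); last by lra.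
  rewrite [in leRHS]normrM [X in _ <= _ * X]ger0_norm ?mulr_ge0 ?powR_ge0//.
  by rewrite -mulrA ler_wpM2l// mulrC ler_wpM2l ?powR_ge0// Hc'//; apply/andP; split; lra.
- have [||c' c'0 Hc'] := powR_lower_bound A (r / 2) r _ _; [lra|lra|].
  apply: (exponent_at_r w (`|- C / p1| * c') (r / 2) r) => //.
  + by rewrite mulr_gt0.
  + by rewrite divr_gt0.
  move: wE; apply: ae_mono => x {}H x0 /andP[rx xr].
  rewrite H// xr.
  rewrite [in leRHS]normrM [X in _ <= _ * X]ger0_norm ?mulr_ge0 ?powR_ge0//.
  by rewrite -mulrA ler_wpM2l// ler_wpM2r ?powR_ge0// Hc'//; apply/andP; split; lra.
Qed.

(** The root of [p] decides: no root leads to a gamma weight, a positive root [r]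
  to a beta weight on [(0, r)], and a root [r <= 0] is impossible because the
  solution on the whole half-line would have infinite moments. *)
Lemma OPE2_classification w omega :
    (forall m, mu.-integrable (Rpos : set R) (EFin \o (fun x => w x * x ^+ m))) ->
    ~ (\forall x \ae mu, 0 < x -> w x = 0) ->
    mult_derivative_type_wrt (@OPE_fun R 2 (ext0 Rpos w)) omega ->
  (exists r A p kappa : R, [/\ 0 < r, -1 < A, -1 < p, kappa != 0 &
     \forall x \ae mu, 0 < x ->
       w x = kappa * (if x < r then x `^ A * (r - x) `^ p else 0)]) \/
  (exists k A kappa : R, [/\ k < 0, -1 < A, kappa != 0 &
     \forall x \ae mu, 0 < x -> w x = kappa * (x `^ A * expR (k * x))]).
Proof.
move=> iw wnz mdt.
have [/(_ isT) [/= [_ co] ACo] _] := mdt.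
have [p0 [p1 [q0 [q1 [e0 [e1 [f0 [f1 H]]]]]]]] := OPE2_relations w omega mdt.
have Hp : \forall x \ae mu, 0 < x -> omega x = (p0 + p1 * x) * w x.
  by move: H; apply: ae_mono => x H /H[].
have Hq : \forall x \ae mu, 0 < x -> euler omega x = (q0 + q1 * x) * w x.
  by move: H; apply: ae_mono => x H /H[].
have p_neq0 : (p0 != 0) || (p1 != 0).
  apply: contrapT => /negP; rewrite negb_or !negbK => /andP[/eqP p00 /eqP p10].
  apply: wnz; apply: (proportional_ae0 w (euler omega) e1 f1).
  move: H; apply: ae_mono => x H /H[oE _ -> ->].
  by rewrite oE p00 p10 !mul0r addr0 mul0r !mulr0 !add0r.
have q_neq0 : (q0 != 0) || (q1 != 0).
  apply: contrapT => /negP; rewrite negb_or !negbK => /andP[/eqP q00 /eqP q10].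
  apply: wnz; apply: (proportional_ae0 w omega e0 f0).
  move: H; apply: ae_mono => x H /H[_ oE -> ->].
  by rewrite oE q00 q10 !mul0r addr0 mul0r !mulr0 !addr0.
have [p10|p10] := eqVneq p1 0.
  have p00 : p0 != 0 by move: p_neq0; rewrite p10 eqxx orbF.
  right.
  have [|||C HC] := omega_solution w omega p0 p1 q0 q1 (q0 / p0) 0 0 (q1 / p0) (-1) 1
    Rpos _ q_neq0 Hp Hq co ACo _ _.
  - exact: interval_is_interval.
  - by move=> x; rewrite /Rpos/= in_itv/= andbT => x0; split=> //; lra.
  - move=> x; rewrite /Rpos/= in_itv/= andbT => x0 _; rewrite p10 mul0r addr0.
    have x0' : x != 0 by rewrite gt_eqF.
    have x1' : x - -1 != 0 by rewrite gt_eqF//; lra.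
    by field; rewrite p00 x0' -[1]opprK x1'.
  have [|k0 A1 wE] := gamma_weight_solution w p0 (q0 / p0) (q1 / p0) C p00 iw wnz.
    move: Hp; apply: ae_mono => x Hp x0.
    by rewrite -HC ?Hp// ?p10 ?mul0r ?addr0// /Rpos/= in_itv/= x0.
  exists (q1 / p0), (q0 / p0), (C / p0); split=> //.
  rewrite mulf_neq0 ?invr_neq0//; apply/eqP => C0; apply: wnz.
  by move: wE; apply: ae_mono => x wE x0; rewrite wE// C0 !mul0r.
left; pose r := - p0 / p1.
have pE x : p0 + p1 * x = p1 * (x - r) by rewrite /r; field.
have [A [B [D [D0 partial_frac]]]] := partial_fractions p1 q0 q1 r p10.
have partial_frac' x : 0 < x -> p0 + p1 * x != 0 ->
    (q0 + q1 * x) / (x * (p0 + p1 * x)) = A / x + B / (x - r) + D / x ^+ 2 + 0.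
  move=> x0; rewrite pE mulf_eq0 negb_or => /andP[_ xr]; exact: partial_frac.
(* Beyond both singular points 0 and r, the solution must vanish. *)
pose l := Num.max 0 r.
have l0 : 0 <= l by rewrite le_max lexx.
have lr : r <= l by rewrite le_max lexx orbT.
have [|||C2 HC2] := omega_solution w omega p0 p1 q0 q1 A B D 0 r 1
    `]l, +oo[ _ q_neq0 Hp Hq co ACo _ _.
- exact: interval_is_interval.
- by move=> x; rewrite /= in_itv/= andbT => xl; split; lra.
- by move=> x; rewrite /= in_itv/= andbT => xl; apply: partial_frac'; lra.
have C20 : C2 = 0.
  apply: (tail_moments_eq0 w A B D 0 r p0 p1 C2 l) => //.
  move: Hp; apply: ae_mono => x Hp lx rx.
  by rewrite -HC2 ?Hp//= ?in_itv/= ?lx//; lra.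
have w0 : \forall x \ae mu, l < x -> w x = 0.
  move: Hp; apply: ae_mono => x Hp lx.
  have x0 : 0 < x by lra.
  have : omega x = 0 by rewrite HC2 ?C20 ?mul0r//= in_itv/= lx.
  rewrite Hp// pE => /eqP; rewrite !mulf_eq0 (negPf p10)/= => /orP[/eqP xr|/eqP//].
  by exfalso; lra.
have r0 : 0 < r.
  rewrite ltNge; apply/negP => r0; apply: wnz.
  by move: w0; rewrite /l max_l.
have lE : l = r by rewrite /l max_r// ltW.
rewrite (D0 _) ?gt_eqF// in partial_frac'.
have [|||C1 HC1] := omega_solution w omega p0 p1 q0 q1 A B 0 0 r (-1)
    `]0, r[ _ q_neq0 Hp Hq co ACo _ _.
- exact: interval_is_interval.
- by move=> x; rewrite /= in_itv/= => /andP[? ?]; split; lra.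
- by move=> x; rewrite /= in_itv/= => /andP[? ?]; apply: partial_frac'.
have [| |C10 A1 B1 wE] := beta_weight_solution w p1 r A B C1 p10 r0 iw wnz.
- move: Hp; apply: ae_mono => x Hp x0 xr.
  by rewrite -HC1 ?Hp ?pE//= in_itv/= x0.
- by rewrite -lE.
exists r, A, (B - 1), (- C1 / p1); split=> //.
by rewrite mulf_neq0 ?oppr_eq0// invr_neq0.
Qed.

End OrderTwo.

(** * Bases of the polynomials of bounded degree *)

Section SpanningPolynomials.
Context {R : realType}.
Local Notation mR := (measurableTypeR R).
Local Notation mu := (@lebesgue_measure R).
Implicit Types (f g w omega : R -> R) (P : nat -> {poly R}) (q : {poly R}).

(** Triangular elimination from the top degree. *)
Lemma span_degree_ladder n P :
    (forall j, (size (P j) <= j.+1)%N) -> (forall j, (j < n)%N -> (P j)`_j != 0) ->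
  forall q, (size q <= n)%N -> exists d : nat -> R, q = \sum_(j < n) d j *: P j.
Proof.
elim: n => [|n IH] sP nP q sq.
  by exists (fun=> 0); rewrite big_ord0; apply/eqP; rewrite -size_poly_leq0.
pose c := q`_n / (P n)`_n.
have [|d dE] := IH sP (fun j jn => nP j (ltnW jn)) (q - c *: P n).
  apply/leq_sizeP => j; rewrite leq_eqVlt => /predU1P[<-|nj].
    by rewrite coefB coefZ /c divfK ?subrr// nP.
  rewrite coefB coefZ !nth_default ?mulr0 ?subr0//; last exact: leq_trans sq _.
  exact: leq_trans (sP n) _.
exists (fun j => if (j < n)%N then d j else c).
rewrite big_ord_recr/= ltnn -[LHS](subrK (c *: P n)) dE; congr (_ + _).
by apply: eq_bigr => j _; rewrite ltn_ord.
Qed.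

(** Triangular elimination on the order of vanishing at [r]: subtracting the right
  multiple of the last generator, which does not vanish at [r], leaves a
  multiple of [X - r], to which the induction hypothesis applies. *)
Lemma span_vanishing_ladder (r : R) n P :
    (forall j, (size (P j) <= j.+1)%N) -> (forall j, (j < n)%N -> (P j).[r] != 0) ->
  forall q, (size q <= n)%N ->
  exists d : nat -> R, q = \sum_(j < n) d j *: ((r%:P - 'X) ^+ (n.-1 - j) * P j).
Proof.
elim: n => [|n IH] sP nP q sq.
  by exists (fun=> 0); rewrite big_ord0; apply/eqP; rewrite -size_poly_leq0.
pose c := q.[r] / (P n).[r].
have /factor_theorem[s sE] : root (q - c *: P n) r.
  by rewrite rootE hornerD hornerN hornerZ /c divfK ?subrr// nP.
have ss : (size s <= n)%N.
  have [->|s0] := eqVneq s 0; first by rewrite size_poly0.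
  have : (size (q - c *: P n)%R <= n.+1)%N.
    rewrite (leq_trans (size_polyD _ _))// geq_max sq size_polyN.
    by rewrite (leq_trans (size_scale_leq _ _)).
  by rewrite sE size_Mmonic ?monicXsubC// size_XsubC addn2.
have [d dE] := IH sP (fun j jn => nP j (ltnW jn)) s ss.
exists (fun j => if (j < n)%N then - d j else c).
rewrite big_ord_recr/= ltnn subnn expr0 mul1r -[LHS](subrK (c *: P n)) sE; congr (_ + _).
rewrite dE mulr_suml; apply: eq_bigr => j _; rewrite ltn_ord.
have -> : (n - j = (n.-1 - j).+1)%N by have := ltn_ord j; lia.
by rewrite exprS -scalerAl scaleNr -scalerN; congr (_ *: _); ring.
Qed.

(** Both spaces are [w] times a space of polynomials, so it suffices to compare
  the latter. *)
Lemma ae_span_polynomials n w (u : 'I_n -> R -> R) (T : 'I_n -> {poly R}) (kappa : R) :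
    kappa != 0 -> (forall j, (size (T j) <= n)%N) ->
    (forall q, (size q <= n)%N -> exists d : 'I_n -> R, q = \sum_(j < n) d j *: T j) ->
    (\forall x \ae mu, 0 < x -> forall j, u j x = kappa^-1 * (T j).[x] * w x) ->
  ae_span (@OPE_fun R n (ext0 Rpos w)) = ae_span u.
Proof.
move=> k0 sT spanT uE.
have W (x : R) : 0 < x -> ext0 Rpos w x = w x.
  by move=> x0; rewrite /ext0 patchE mem_set// /Rpos/= in_itv/= x0.
apply/seteqP; split=> f [c fE].
- have [|d dE] := spanT (\sum_(i < n) (kappa * c i) *: 'X^i).
    apply: (leq_trans (size_sum _ _ _)); apply/bigmax_leqP => i _.
    by rewrite (leq_trans (size_scale_leq _ _))// size_polyXn.
  exists d; move: (ae_and fE uE); apply: ae_mono => x [{}fE {}uE] xpos.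
  have x0 : 0 < x by move: xpos; rewrite /Rpos/= in_itv/= andbT.
  rewrite fE//; under [RHS]eq_bigr do rewrite uE//.
  transitivity (kappa^-1 * (\sum_(i < n) (kappa * c i) *: 'X^i).[x] * w x).
    rewrite horner_sum mulr_sumr mulr_suml; apply: eq_bigr => i _.
    by rewrite /OPE_fun W// hornerZ hornerXn; field.
  rewrite dE horner_sum mulr_sumr mulr_suml; apply: eq_bigr => i _.
  by rewrite hornerZ; ring.
- pose q := \sum_(i < n) c i *: T i.
  exists (fun i => kappa^-1 * q`_i).
  move: (ae_and fE uE); apply: ae_mono => x [{}fE {}uE] xpos.
  have x0 : 0 < x by move: xpos; rewrite /Rpos/= in_itv/= andbT.
  rewrite fE//; under eq_bigr do rewrite uE//.
  transitivity (kappa^-1 * q.[x] * w x).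
    rewrite /q horner_sum mulr_sumr mulr_suml; apply: eq_bigr => i _.
    by rewrite hornerZ; ring.
  rewrite (@horner_coef_wide _ n q x).
    rewrite mulr_sumr mulr_suml; apply: eq_bigr => i _.
    by rewrite /OPE_fun W//; ring.
  apply: (leq_trans (size_sum _ _ _)); apply/bigmax_leqP => i _.
  by rewrite (leq_trans (size_scale_leq _ _)).
Qed.

Lemma powR_expD (a c x : R) : 0 < x -> x `^ (a + c) = x `^ a * x `^ c.
Proof. by move=> x0; rewrite powRD// (gt_eqF x0) implybT. Qed.

Lemma powR_mulS (a x : R) : 0 < x -> x `^ a = x * x `^ (a - 1).
Proof.
move=> x0; have := powR_expD (a - 1) 1 x x0.
by rewrite subrK powRr1 ?ltW// => ->; rewrite mulrC.
Qed.

End SpanningPolynomials.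

(** * Truncated powers *)

Section TruncatedPowers.
Context {R : realType}.
Local Notation mR := (measurableTypeR R).
Local Notation mu := (@lebesgue_measure R).
Implicit Types (f g w omega : R -> R) (q : {poly R}).

Lemma is_derive_continuous f (x d : R) : is_derive x 1 f d -> {for x, continuous f}.
Proof. by move=> [df _]; apply: differentiable_continuous; exact/derivable1_diffP. Qed.

Lemma abs_continuous_mulC1 (a b : R) f g g' :
    (forall x, a <= x <= b -> {for x, continuous f}) ->
    abs_continuous_itv a b f ->
    (forall x : R, a <= x <= b -> is_derive x 1 g (g' x)) ->
    (forall x, a <= x <= b -> {for x, continuous g'}) ->
  abs_continuous_itv a b (fun x => f x * g x).
Proof.
move=> cf acf dg cg'.
have [F F0 HF] := continuous_bounded_itv a b f cf.
have [G G0 HG] := continuous_bounded_itv a b g (fun x xab => is_derive_continuous g x _ (dg x xab)).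
have [K K0 HK] := C1_lipschitz_itv a b g g' dg cg'.
apply: abs_continuousM HF HG acf _.
exact: abs_continuous_lipschitz HK.
Qed.

Definition trunc_pow (r c x : R) : R := if x < r then (r - x) `^ c else 0.

Lemma is_derive_powR_left (r c x : R) : x < r ->
  is_derive x 1 (fun x => (r - x) `^ c) (- (c * (r - x) `^ (c - 1))).
Proof.
move=> xr; have rx0 : 0 < r - x by lra.
have drx : is_derive x 1 (fun x => r - x) (- 1 : R).
  apply: is_derive_eq (is_deriveB (is_derive_cst r x 1) (is_derive_id x 1)) _.
  by rewrite sub0r.
apply: is_derive_eq (@is_derive1_comp _ (@powR R ^~ c) (fun x => r - x) _ _ _
  (is_derive1_powR c rx0) drx) _.
by rewrite mulrN1.
Qed.

Lemma is_derive_trunc_pow (r c x : R) : x != r ->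
  is_derive x 1 (trunc_pow r c) (- (c * trunc_pow r (c - 1) x)).
Proof.
rewrite neq_lt => /orP[xr|rx].
  rewrite {2}/trunc_pow xr.
  apply: (is_derive_local `]-oo, r[ _ (fun x => (r - x) `^ c)).
  - exact: interval_open.
  - by rewrite /= in_itv.
  - by move=> y /=; rewrite in_itv/= /trunc_pow => ->.
  - exact: is_derive_powR_left.
rewrite {2}/trunc_pow ltNge (ltW rx)/= mulr0 oppr0.
apply: (is_derive_local `]r, +oo[ _ (cst 0)).
- exact: interval_open.
- by rewrite /= in_itv/= rx.
- by move=> y /=; rewrite in_itv/= andbT /trunc_pow => ry; rewrite ltNge ltW.
Qed.

Lemma continuous_trunc_pow (r c x : R) : 0 < c -> {for x, continuous (trunc_pow r c)}.
Proof.
move=> c0; have [->|xr] := eqVneq x r; last first.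
  by apply: is_derive_continuous; exact: is_derive_trunc_pow.
apply/cvgrPdist_lt => e e0.
rewrite -nbhs_nearE; apply/nbhs_ballP; exists (e `^ c^-1); first exact: powR_gt0.
move=> y; rewrite /ball/= => ry; rewrite /trunc_pow ltxx sub0r normrN.
case: (ltP y r) => [yr|_]; last by rewrite normr0.
rewrite ger0_norm ?powR_ge0// (_ : e = (e `^ c^-1) `^ c); last first.
  by rewrite -powRrM mulVf ?gt_eqF// powRr1// ltW.
apply: gt0_ltr_powR => //; rewrite ?nnegrE ?powR_ge0//; first lra.
by move: ry; rewrite ger0_norm//; lra.
Qed.

(** The difference quotient at [r] is, up to sign, the truncated power of
  exponent [c - 1 > 0], which tends to [0]. *)
Lemma is_derive_trunc_pow_end (r c : R) : 1 < c ->
  is_derive r 1 (trunc_pow r c) (- (c * trunc_pow r (c - 1) r)).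
Proof.
move=> c1; have c10 : 0 < c - 1 by lra.
have T0 c' : trunc_pow r c' r = 0 by rewrite /trunc_pow ltxx.
rewrite T0 mulr0 oppr0.
have E (y : R) : trunc_pow r c y = (r - y) * trunc_pow r (c - 1) y.
  rewrite /trunc_pow; case: ltP => yr; last by rewrite mulr0.
  by rewrite [LHS]powR_mulS//; lra.
have H : h^-1 *: (trunc_pow r c (h%:A + r) - trunc_pow r c r) @[h --> 0^'] --> (0 : R).
  have : (fun h : R => - trunc_pow r (c - 1) (h + r)) @ 0^' --> (0 : R).
    rewrite -[X in _ --> X]oppr0; apply: cvgN; apply: cvg_within_filter.
    have cr := continuous_trunc_pow r (c - 1) r c10.
    rewrite /prop_for /continuous_at T0 in cr.
    have hr : (fun h : R => h + r) @ (0 : R) --> r.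
      by rewrite -[X in _ --> X]add0r; apply: cvgD; [exact: cvg_id|exact: cvg_cst].
    exact: (cvg_comp _ _ hr cr).
  apply: cvg_trans; apply: near_eq_cvg; near=> h.
  have h0 : h != 0 by near: h; exact: nbhs_dnbhs_neq.
  rewrite T0 subr0 E scaler1 opprD addrCA subrr addr0 /GRing.scale/=.
  by rewrite mulrA mulrN mulVf// mulN1r.
apply: DeriveDef; first by apply/cvg_ex; exists 0.
exact: (cvg_lim _ H).
Unshelve. all: by end_near. Qed.

(** For [c < 1] the derivative blows up at [r], but the truncated power is
  monotone, Lipschitz away from [r], and small near [r].  The interval is first
  enlarged so that it contains [r] and [r - 1]. *)
Lemma abs_continuous_trunc_pow (r c a b : R) : 0 < c ->
  abs_continuous_itv a b (trunc_pow r c).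
Proof.
move=> c0; pose a' := Num.min a (r - 1); pose b' := Num.max b r.
have aa' : a' <= a by rewrite ge_min lexx.
have ar' : a' <= r - 1 by rewrite ge_min lexx orbT.
have bb' : b <= b' by rewrite le_max lexx.
have rb' : r <= b' by rewrite le_max lexx orbT.
apply: (abs_continuous_itvS a' b') => //.
apply: abs_continuous_nonincreasing.
  move=> x y _ xy _; rewrite /trunc_pow; case: ltP => yr;
    last by case: ltP => // _; exact: powR_ge0.
  rewrite (le_lt_trans xy yr); apply: ge0_ler_powR; rewrite ?nnegrE; lra.
move=> e e0.
(* eta is small enough for eta ^ c <= e / 2. *)
pose eta := Num.min 1 ((e / 2) `^ c^-1).
have e20 : 0 < e / 2 by rewrite divr_gt0.
have eta0 : 0 < eta by rewrite lt_min ltr01 powR_gt0.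
have eta1 : eta <= 1 by rewrite ge_min lexx.
have [||K K0 HK] := C1_lipschitz_itv a' (r - eta) (fun x => (r - x) `^ c)
    (fun x => - (c * (r - x) `^ (c - 1))).
- by move=> x /andP[_ xr]; apply: is_derive_powR_left; lra.
- move=> x /andP[_ xr]; apply: cvgN; apply: cvgM; first exact: cvg_cst.
  apply: (is_derive_continuous (fun x => (r - x) `^ (c - 1)) x).
  by apply: is_derive_powR_left; lra.
exists (r - eta), K; split; [lra|lra| |].
  have l1 : r - eta < r by lra.
  have l2 : (b' < r) = false by apply/negbTE; rewrite -leNgt.
  rewrite /trunc_pow l1 l2.
  rewrite subr0 subKr (@le_lt_trans _ _ (((e / 2) `^ c^-1) `^ c))//.
    by apply: ge0_ler_powR; rewrite ?nnegrE ?powR_ge0 ?ge_min ?lexx ?orbT// ltW.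
  by rewrite -powRrM mulVf ?gt_eqF// powRr1; lra.
move=> x y ax xy yr; have := HK x y ax xy yr.
have xr : x < r by lra.
have yr' : y < r by lra.
rewrite /trunc_pow xr yr'.
by rewrite distrC; have := ler_norm ((r - x) `^ c - (r - y) `^ c); lra.
Qed.

(** * Weights of beta type *)

Definition beta_fun (r a c : R) q (x : R) : R := x `^ a * trunc_pow r c x * q.[x].

(** [beta_fun r a c q] has derivative
  [beta_fun r (a - 1) (c - 1) (beta_step r a c q)]. *)
Definition beta_step (r a c : R) q : {poly R} :=
  a *: ((r%:P - 'X) * q) - c *: ('X * q) + 'X * (r%:P - 'X) * q^`().

(** The product rule, after factoring out the lower powers; at [r], where both
  sides vanish, this relies on [1 < c]. *)
Lemma is_derive_beta_fun (r a c x : R) q : 0 < x -> (1 < c) || (x != r) ->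
  is_derive x 1 (beta_fun r a c q) (beta_fun r (a - 1) (c - 1) (beta_step r a c q) x).
Proof.
move=> x0 cx.
have dT : is_derive x 1 (trunc_pow r c) (- (c * trunc_pow r (c - 1) x)).
  case: eqVneq cx => [-> |xr _]; last exact: is_derive_trunc_pow.
  by rewrite orbF; exact: is_derive_trunc_pow_end.
have d := is_deriveM (is_deriveM (is_derive1_powR a x0) dT) (is_derive_poly q x).
apply: is_derive_eq d _.
rewrite !fctE /GRing.scale/= /beta_fun /beta_step.
rewrite !(hornerD, hornerN, hornerZ, hornerM, hornerX, hornerC).
rewrite (powR_mulS a x x0).
have -> : trunc_pow r c x = (r - x) * trunc_pow r (c - 1) x.
  rewrite /trunc_pow; case: ltP => xr; last by rewrite mulr0.
  by rewrite [LHS]powR_mulS//; lra.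
ring.
Qed.

Lemma size_beta_step (r a c : R) q : (size (beta_step r a c q) <= (size q).+1)%N.
Proof.
have sX : (size (r%:P - 'X : {poly R})%R <= 2)%N by rewrite -opprB size_polyN size_XsubC.
have sM (p1 p2 : {poly R}) m : (size p1 <= 2)%N -> (size p2 <= m)%N -> (size (p1 * p2)%R <= m.+1)%N.
  move=> s1 s2; rewrite (leq_trans (size_polyMleq _ _))//; lia.
rewrite (leq_trans (size_polyD _ _))// geq_max; apply/andP; split.
  rewrite (leq_trans (size_polyD _ _))// geq_max size_polyN.
  by rewrite !(leq_trans (size_scale_leq _ _))// sM// size_polyX.
have [->|q0] := eqVneq q 0; first by rewrite deriv0 mulr0 size_poly0.
rewrite -mulrA sM ?size_polyX// (leq_trans (sM _ _ (size q).-1 sX _))//.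
  by have := lt_size_deriv q0; case: (size q).
by rewrite prednK// lt0n size_poly_eq0.
Qed.

(** Only the term that differentiates the power of [r - x] survives at [r]. *)
Lemma beta_step_at_root (r a c : R) q : (beta_step r a c q).[r] = - c * r * q.[r].
Proof.
rewrite /beta_step !(hornerD, hornerN, hornerZ, hornerM, hornerX, hornerC); ring.
Qed.

End TruncatedPowers.

(** * Ensembles of derivative type for beta weights *)

Section DerivativeType.
Context {R : realType}.
Local Notation mR := (measurableTypeR R).
Local Notation mu := (@lebesgue_measure R).
Implicit Types (f g w omega : R -> R) (q : {poly R}).

Lemma is_derive_powR_horner (a x : R) q : 0 < x ->
  is_derive x 1 (fun x => x `^ a * q.[x]) (x `^ a * q^`().[x] + q.[x] * (a * x `^ (a - 1))).
Proof.
move=> x0; exact: (is_deriveM (is_derive1_powR a x0) (is_derive_poly q x)).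
Qed.

Lemma continuous_powR_horner (a x : R) q : 0 < x ->
  {for x, continuous (fun x => x `^ a * q.[x])}.
Proof. by move=> x0; exact: is_derive_continuous (is_derive_powR_horner a x q x0). Qed.

Lemma continuous_powR_horner_slope (a x : R) q : 0 < x ->
  {for x, continuous (fun x => x `^ a * q^`().[x] + q.[x] * (a * x `^ (a - 1)))}.
Proof.
move=> x0; apply: cvgD; first exact: continuous_powR_horner.
apply: cvgM; first exact: continuous_horner.
by apply: cvgM; [exact: cvg_cst | exact: is_derive_continuous (is_derive1_powR _ x0)].
Qed.

Lemma beta_funE (r a c : R) q :
  beta_fun r a c q = (fun x => trunc_pow r c x * (x `^ a * q.[x])).
Proof. by apply/funext => x; rewrite /beta_fun; ring. Qed.

Lemma continuous_beta_fun (r a c x : R) q : 0 < c -> 0 < x ->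
  {for x, continuous (beta_fun r a c q)}.
Proof.
move=> c0 x0; rewrite beta_funE; apply: cvgM; first exact: continuous_trunc_pow.
exact: continuous_powR_horner.
Qed.

Lemma loc_abs_continuous_beta_fun (r a c : R) q : 0 < c ->
  loc_abs_continuous_pos (beta_fun r a c q).
Proof.
move=> c0 u v u0 uv; rewrite beta_funE.
apply: (abs_continuous_mulC1 _ _ _ _ (fun x => x `^ a * q^`().[x] + q.[x] * (a * x `^ (a - 1)))).
- by move=> x _; exact: continuous_trunc_pow.
- exact: abs_continuous_trunc_pow.
- by move=> x /andP[ux _]; apply: is_derive_powR_horner; lra.
- by move=> x /andP[ux _]; apply: continuous_powR_horner_slope; lra.
Qed.

(** The polynomial factor after [k] steps, when each step lowers the exponent at
  [0] by [da]: [da = 1] for ordinary derivatives, and [da = 0] for Euler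
  derivatives, where the multiplication by [x] restores that exponent. *)
Fixpoint beta_poly (r a da c : R) (k : nat) : {poly R} :=
  if k is j.+1 then beta_step r (a - j%:R * da) (c - j%:R) (beta_poly r a da c j) else 1.

Lemma size_beta_poly (r a da c : R) k : (size (beta_poly r a da c k) <= k.+1)%N.
Proof.
elim: k => [|k IH]; first by rewrite /= size_poly1.
by rewrite (leq_trans (size_beta_step _ _ _ _)).
Qed.

Lemma beta_poly_neq0 (r a da c : R) k : 0 < r -> k%:R < c + 1 ->
  (beta_poly r a da c k).[r] != 0.
Proof.
move=> r0; elim: k => [|k IH kc]; first by rewrite /= hornerC oner_eq0.
rewrite -natr1 in kc.
have ck : c - k%:R != 0 by rewrite gt_eqF//; lra.
rewrite /= beta_step_at_root mulf_neq0 ?mulf_neq0 ?oppr_eq0 ?(gt_eqF r0)//.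
by apply: IH; lra.
Qed.

(** Witness: [omega = x^A (r - x)^(p + n - 1)] on [(0, r)].  Each Euler derivative
  lowers the exponent at [r] by one, and the last of the [n - 1] reaches [p]. *)
Lemma beta_mult_derivative_type n w (r A p kappa : R) : (1 <= n)%N -> 0 < r -> -1 < p ->
    kappa != 0 -> (\forall x \ae mu, 0 < x ->
      w x = kappa * (if x < r then x `^ A * (r - x) `^ p else 0)) ->
  exists omega, mult_derivative_type_wrt (@OPE_fun R n (ext0 Rpos w)) omega.
Proof.
move=> n1 r0 p1 k0 wE; pose c := p + n.-1%:R; pose omega := beta_fun r A c 1.
exists omega; split.
  move=> n2.
  (* The exponents c - k met before the last derivative exceed 1, which is what
     differentiability at r requires; the last one is p + 1 > 0. *)
  apply: (C_pos_chain omega (fun k => beta_fun r (A - k%:R) (c - k%:R) (beta_poly r A 1 c k))).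
  - by move=> x _; rewrite !subr0.
  - move=> k kn x x0; rewrite -natr1 !opprD !addrA /= mulr1.
    apply: is_derive_beta_fun => //; apply/orP; left.
    have : k.+2%:R <= n.-1%:R :> R by rewrite ler_nat; lia.
    by rewrite /c -!natr1; lra.
  - move=> x x0; apply: continuous_beta_fun => //.
    rewrite /c; have -> : n.-1 = (n - 2).+1 by lia.
    by rewrite -natr1; lra.
  - apply: loc_abs_continuous_beta_fun.
    rewrite /c; have -> : n.-1 = (n - 2).+1 by lia.
    by rewrite -natr1; lra.
pose P := beta_poly r A 0 c.
have euE k x : (Rpos `&` [set~ r]) x -> iter k euler omega x = beta_fun r A (c - k%:R) (P k) x.
  apply: (@euler_chain _ omega _ (fun k => beta_fun r A (c - k%:R) (P k))).
  - by apply: openI; [exact: interval_open | exact/closed_openC/closed_eq].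
  - by move=> y [].
  - by move=> y _; rewrite /= subr0.
  - move=> j y [ypos /eqP yr]; have y0 : 0 < y by move: ypos; rewrite /Rpos/= in_itv/= andbT.
    apply: is_derive_eq (is_derive_beta_fun r A (c - j%:R) y (P j) y0 _) _.
      by rewrite yr orbT.
    rewrite /P/= mulr0 subr0 /beta_fun (powR_mulS A y y0) -natr1 opprD addrA.
    by field; rewrite gt_eqF.
pose T (j : 'I_n) := (r%:P - 'X) ^+ (n.-1 - j) * P j.
have sP j : (size (P j) <= j.+1)%N by exact: size_beta_poly.
apply: (@ae_span_polynomials R n w _ T kappa) => //.
- move=> j; rewrite /T (leq_trans (size_polyMleq _ _))//.
  have sX : (size (r%:P - 'X : {poly R})%R = 2)%N by rewrite -opprB size_polyN size_XsubC.
  have := size_poly_exp_leq (r%:P - 'X) (n.-1 - j); rewrite sX mul1n.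
  have := sP j; have := ltn_ord j; lia.
- move=> q sq; have [|d dE] := @span_vanishing_ladder R r n P sP _ q sq.
    move=> j jn; apply: beta_poly_neq0 => //.
    have : j%:R <= n.-1%:R :> R by rewrite ler_nat; lia.
    by rewrite /c; lra.
  by exists (fun j => d j).
- have ae_r : \forall x \ae mu, - r + 1 * x != 0.
    by apply: ae_affine_neq0; rewrite oner_neq0 orbT.
  move: (ae_and wE ae_r); apply: ae_mono => x [{}wE xr] x0 j.
  rewrite euE; last first.
    split; first by rewrite /Rpos/= in_itv/= x0.
    by move=> xr'; move: xr; rewrite xr' mul1r addNr eqxx.
  rewrite wE// /T hornerM horner_exp hornerD hornerN hornerC hornerX /beta_fun /trunc_pow.
  case: (ltP x r) => [xltr|_]; last by rewrite !mulr0 mul0r.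
  have rx0 : 0 < r - x by lra.
  have -> : c - j%:R = p + (n.-1 - j)%:R.
    by rewrite /c natrB ?addrA//; have := ltn_ord j; lia.
  rewrite powR_expD// powR_mulrn ?ltW//; field.
  exact: k0.
Qed.

(** * Weights of gamma type *)

Definition gamma_fun (k a : R) q (x : R) : R := expR (k * x) * (x `^ a * q.[x]).

Definition gamma_step (k a : R) q : {poly R} := a *: q + k *: ('X * q) + 'X * q^`().

Lemma is_derive_expR_lin (k x : R) : is_derive x 1 (fun x => expR (k * x)) (k * expR (k * x)).
Proof.
have dk : is_derive x 1 (fun x => k * x) k.
  apply: is_derive_eq (is_deriveZ k (is_derive_id x 1)) _; exact: mulr1.
rewrite mulrC; exact: (@is_derive1_comp _ (@expR R) (fun x => k * x) _ _ _ (is_derive_expR _) dk).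
Qed.

Lemma is_derive_gamma_fun (k a x : R) q : 0 < x ->
  is_derive x 1 (gamma_fun k a q) (gamma_fun k (a - 1) (gamma_step k a q) x).
Proof.
move=> x0.
apply: is_derive_eq (is_deriveM (is_derive_expR_lin k x) (is_derive_powR_horner a x q x0)) _.
rewrite /GRing.scale/= /gamma_fun /gamma_step !(hornerD, hornerZ, hornerM, hornerX).
by rewrite (powR_mulS a x x0); ring.
Qed.

(** As for [beta_poly], [da] is [1] for ordinary derivatives and [0] for Euler
  derivatives. *)
Fixpoint gamma_poly (k a da : R) (n : nat) : {poly R} :=
  if n is j.+1 then gamma_step k (a - j%:R * da) (gamma_poly k a da j) else 1.

Lemma size_gamma_poly (k a da : R) n : (size (gamma_poly k a da n) <= n.+1)%N.
Proof.
elim: n => [|n IH]; first by rewrite /= size_poly1.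
rewrite /= /gamma_step (leq_trans (size_polyD _ _))// geq_max; apply/andP; split.
  rewrite (leq_trans (size_polyD _ _))// geq_max !(leq_trans (size_scale_leq _ _))//.
    by rewrite (leq_trans (size_polyMleq _ _))// size_polyX.
  exact: leq_trans IH _.
rewrite (leq_trans (size_polyMleq _ _))// size_polyX/=.
have [->|q0] := eqVneq (gamma_poly k a da n) 0; first by rewrite deriv0 size_poly0.
by rewrite ltnS (leq_trans (ltnW (lt_size_deriv q0))).
Qed.

Lemma coef_gamma_poly (k a da : R) n : (gamma_poly k a da n)`_n = k ^+ n.
Proof.
elim: n => [|n IH]; first by rewrite /= coefC expr0.
rewrite /= /gamma_step !coefD !coefZ !coefXM /= coef_deriv IH exprS.
by rewrite nth_default ?size_gamma_poly// mulr0 mul0rn add0r addr0.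
Qed.

(** Witness: [omega = w] up to a factor and a null set.  Its [j]-th Euler
  derivative is [w] times a polynomial whose coefficient of degree [j] is
  [k ^ j], which does not vanish. *)
Lemma gamma_mult_derivative_type n w (k A kappa : R) : k != 0 ->
    kappa != 0 -> (\forall x \ae mu, 0 < x -> w x = kappa * (x `^ A * expR (k * x))) ->
  exists omega, mult_derivative_type_wrt (@OPE_fun R n (ext0 Rpos w)) omega.
Proof.
move=> k0 kap0 wE; pose omega := gamma_fun k A 1.
pose F j := gamma_fun k (A - j%:R) (gamma_poly k A 1 j).
have dF j (x : R) : 0 < x -> is_derive x 1 (F j) (F j.+1 x).
  move=> x0; rewrite /F -natr1 opprD addrA /= mulr1; exact: is_derive_gamma_fun.
exists omega; split.
  move=> n2; apply: (C_pos_chain omega F).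
  - by move=> x _; rewrite /F subr0.
  - by move=> x x0; exact: is_derive_continuous (dF _ _ x0).
  - move=> u v u0 uv.
    have pos x : u <= x <= v -> 0 < x by move=> /andP[? _]; lra.
    have [||K K0 HK] := C1_lipschitz_itv u v (F (n - 2)%N) (F (n - 2).+1).
    + by move=> x /pos; exact: dF.
    + by move=> x /pos x0; exact: is_derive_continuous (dF _ _ x0).
    + exact: abs_continuous_lipschitz HK.
pose P := gamma_poly k A 0.
have euE j x : Rpos x -> iter j euler omega x = gamma_fun k A (P j) x.
  apply: (@euler_chain _ omega Rpos (fun j => gamma_fun k A (P j))) => //.
  move=> i y; rewrite /Rpos/= in_itv/= andbT => y0.
    apply: is_derive_eq (is_derive_gamma_fun k A y (P i) y0) _.
    rewrite /P/= mulr0 subr0 /gamma_fun (powR_mulS A y y0).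
    by field; rewrite gt_eqF.
have sP j : (size (P j) <= j.+1)%N by exact: size_gamma_poly.
apply: (@ae_span_polynomials R n w _ (fun j => P j) kappa) => //.
- by move=> j; rewrite (leq_trans (sP j)).
- move=> q sq; have [|d dE] := @span_degree_ladder R n P sP _ q sq.
    by move=> j _; rewrite coef_gamma_poly expf_neq0.
  by exists (fun j => d j).
- move: wE; apply: ae_mono => x wE x0 j.
  rewrite euE ?wE// /gamma_fun; first by field.
  by rewrite /Rpos/= in_itv/= x0.
Qed.

End DerivativeType.

(** * The classification *)

Section Classification.
Context {R : realType}.
Local Notation mR := (measurableTypeR R).
Local Notation mu := (@lebesgue_measure R).
Implicit Types (w : R -> R) (Sigma : set R).

Lemma ext0_pos (D : set R) w x : D x -> ext0 D w x = w x.
Proof. by move=> Dx; rewrite /ext0 patchE mem_set. Qed.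

Lemma ext0_neg (D : set R) w x : ~ D x -> ext0 D w x = 0.
Proof. by move=> Dx; rewrite /ext0 patchE memNset. Qed.

Lemma RposE (x : R) : Rpos x = (0 < x) :> Prop.
Proof. by rewrite /Rpos/= in_itv/= andbT. Qed.

Lemma mellin_moments Sigma w : mellin_interval Sigma -> mellin_L1 Sigma w ->
  forall m, mu.-integrable (Rpos : set R) (EFin \o (fun x => w x * x ^+ m)).
Proof.
move=> [_ _ _ S1] wL1 m; have := wL1 _ (S1 m.+1 isT).
apply: eq_integrable; first exact: measurable_itv.
move=> x; rewrite inE RposE => x0 /=.
by rewrite -natr1 addrK powR_mulrn// ltW.
Qed.

Lemma measurable_ext0 (D : set mR) w : measurable D -> measurable_fun D w ->
  measurable_fun (setT : set mR) (ext0 D w).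
Proof. by move=> mD; rewrite [X in X -> _](measurable_restrictT w mD). Qed.

Lemma measurable_mellin Sigma w : mellin_interval Sigma -> mellin_L1 Sigma w ->
  measurable_fun (setT : set mR) (ext0 Rpos w).
Proof.
move=> SI wL1; apply: measurable_ext0; first exact: measurable_itv.
have /integrableP[/measurable_EFinP + _] := mellin_moments _ _ SI wL1 0%N.
by apply: eq_measurable_fun => x _; rewrite expr0 mulr1.
Qed.

Lemma measurable_jacobi_weight (a b : R) :
  measurable_fun (setT : set mR) (jacobi_weight a b).
Proof.
apply: measurable_ext0; first exact: measurable_itv.
apply: open_continuous_measurable_fun; first exact: interval_open.
move=> x; rewrite inE/= in_itv/= => /andP[x0 x1]; apply: cvgM.
  exact: is_derive_continuous (is_derive1_powR _ x0).
exact: is_derive_continuous (is_derive_powR_left _ _ _ x1).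
Qed.

Lemma measurable_laguerre_weight (a : R) :
  measurable_fun (setT : set mR) (laguerre_weight a).
Proof.
apply: measurable_ext0; first exact: measurable_itv.
apply: open_continuous_measurable_fun; first exact: interval_open.
move=> x; rewrite inE RposE => x0; apply: cvgM.
  exact: is_derive_continuous (is_derive1_powR _ x0).
apply: (@continuous_comp _ _ _ -%R expR); first exact: opp_continuous.
exact: continuous_expR.
Qed.

Lemma ext0_dilation (l : R) w : 0 < l ->
  ext0 Rpos (dilation l w) = dilation l (ext0 Rpos w).
Proof.
move=> l0; apply/funext => x; rewrite /dilation.
have [x0|x0] := ltP 0 x.
  by rewrite !ext0_pos ?RposE// mulr_gt0.
by rewrite !ext0_neg// RposE ltNge ?pmulr_rle0// x0.
Qed.

Lemma not_ae0_of_PE_norm w : measurable_fun (setT : set mR) (ext0 Rpos w) ->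
  PE_norm (@OPE_fun R 1 (ext0 Rpos w)) != 0 -> ~ (\forall x \ae mu, 0 < x -> w x = 0).
Proof.
move=> mw /eqP norm0 w0; apply: norm0.
rewrite /PE_norm /Rintegral -[RHS]/(fine 0%E) -(@integral0 _ _ _ (lebesgue_tuple 1) setT).
congr fine; apply: ae_eq_integral => //.
  by apply/measurable_EFinP; exact: measurable_PE_weight.
have : \forall x \ae mu, ext0 Rpos w x = 0.
  move: w0; apply: ae_mono => x w0; have [x0|x0] := ltP 0 x.
    by rewrite ext0_pos ?RposE// w0.
  by rewrite ext0_neg// RposE ltNge x0.
move=> /(ae_tnth 1); apply: ae_mono.
by move=> x wx _ /=; rewrite PE_weight1 wx.
Qed.

Lemma dilation_beta (r A p : R) (x : R) : 0 < r -> 0 < x ->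
  (if r * x < r then (r * x) `^ A * (r - r * x) `^ p else 0) =
  r `^ A * r `^ p * jacobi_weight A (A + p + 1) x.
Proof.
move=> r0 x0; rewrite gtr_pMr//; case: ltP => x1; last first.
  by rewrite /jacobi_weight ext0_neg ?mulr0//= in_itv/= x0/= ltNge x1.
rewrite /jacobi_weight ext0_pos/= ?in_itv/= ?x0//.
have -> : A + p + 1 - A - 1 = p by ring.
have -> : r - r * x = r * (1 - x) by ring.
by rewrite !powRM ?subr_ge0 ?(ltW r0) ?(ltW x0) ?(ltW x1)//; ring.
Qed.

Lemma dilation_gamma (l A : R) (x : R) : 0 < l -> 0 < x ->
  (l * x) `^ A * expR (- l^-1 * (l * x)) = l `^ A * laguerre_weight A x.
Proof.
move=> l0 x0; rewrite /laguerre_weight ext0_pos ?RposE// powRM ?ltW//.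
by rewrite mulNr mulKf ?gt_eqF// mulrA.
Qed.

Lemma jacobi_weight_neg (a b x : R) : x <= 0 -> jacobi_weight a b x = 0.
Proof. by move=> x0; rewrite /jacobi_weight ext0_neg//= in_itv/= ltNge x0. Qed.

Lemma laguerre_weight_neg (a x : R) : x <= 0 -> laguerre_weight a x = 0.
Proof. by move=> x0; rewrite /laguerre_weight ext0_neg// RposE ltNge x0. Qed.

Lemma ae_dilation_ext0 w (J : R -> R) (l kappa : R) : 0 < l ->
    (forall x, x <= 0 -> J x = 0) ->
    (\forall x \ae mu, 0 < x -> w (l * x) = kappa * J x) ->
  \forall x \ae mu, ext0 Rpos (dilation l w) x = kappa * J x.
Proof.
move=> l0 J0; apply: ae_mono => x wx; have [x0|x0] := ltP 0 x.
  by rewrite ext0_pos ?RposE// /dilation wx.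
by rewrite ext0_neg ?J0 ?mulr0// RposE ltNge x0.
Qed.

Lemma ae_undilation w (J : R -> R) (l kappa : R) : 0 < l ->
    (\forall x \ae mu, ext0 Rpos (dilation l w) x = kappa * J x) ->
  \forall x \ae mu, 0 < x -> w x = kappa * J (l^-1 * x).
Proof.
move=> l0 H; have l'0 : 0 < l^-1 by rewrite invr_gt0.
move: (ae_dilation _ _ l'0 H); apply: ae_mono => x <- x0.
by rewrite ext0_pos ?RposE ?mulr_gt0// /dilation mulVKf// gt_eqF.
Qed.

(** Restriction to the half-line commutes with dilations, and dilations are
  invertible. *)
Lemma OPE_well_defined_dilation (l : R) n w : 0 < l ->
    measurable_fun (setT : set mR) (ext0 Rpos w) ->
  PE_well_defined (@OPE_fun R n (ext0 Rpos w)) <->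
  PE_well_defined (@OPE_fun R n (ext0 Rpos (dilation l w))).
Proof.
move=> l0 mw; have mc (c : R) (f : R -> R) : measurable_fun (setT : set mR) f ->
    measurable_fun (setT : set mR) (dilation c f).
  by move=> mf; apply: (measurableT_comp mf); exact: measurable_funM.
rewrite ext0_dilation//; split=> wd; first exact: PE_well_defined_dilation.
have l'0 : 0 < l^-1 by rewrite invr_gt0.
rewrite (_ : ext0 Rpos w = dilation l^-1 (dilation l (ext0 Rpos w))).
  by apply: PE_well_defined_dilation => //; exact: mc.
by apply/funext => x; rewrite /dilation mulVKf// gt_eqF.
Qed.

End Classification.

Theorem proposition2p7 (R : realType) (Sigma : set R) (w : R -> R)
    (Sigma_itv : mellin_interval Sigma) (w_L1 : mellin_L1 Sigma w) :
  (forall n : nat, (1 <= n)%N -> OPE_mult_derivative_type n (ext0 Rpos w)) <->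
  (exists lambda : R, 0 < lambda /\
     ((exists a b : R, [/\ -1 < a, a < b &
         forall n : nat, (1 <= n)%N ->
           OPE_eq n (ext0 Rpos (dilation lambda w)) (jacobi_weight a b)]) \/
      (exists a : R, -1 < a /\
         forall n : nat, (1 <= n)%N ->
           OPE_eq n (ext0 Rpos (dilation lambda w)) (laguerre_weight a)))).
Proof.
have mw := measurable_mellin _ _ Sigma_itv w_L1.
have iw := mellin_moments _ _ Sigma_itv w_L1.
split=> [mdt|[l [l0 H]]].
- have [[_ norm1 _] _] := mdt 1%N isT.
  have wnz := not_ae0_of_PE_norm _ mw norm1.
  have [_ [omega mdt2]] := mdt 2%N isT.
  have conclude (l : R) (J : R -> R) (kappa : R) : 0 < l ->
      kappa != 0 -> (forall x, x <= 0 -> J x = 0) ->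
      measurable_fun (setT : set (measurableTypeR R)) J ->
      (\forall x \ae lebesgue_measure, 0 < x -> w (l * x) = kappa * J x) ->
      forall n, (1 <= n)%N -> OPE_eq n (ext0 Rpos (dilation l w)) J.
    move=> l0 k0 J0 mJ wJ n n1; have [wd _] := mdt n n1.
    apply: (@PE_eq_proportional R n _ _ kappa) => //.
    + rewrite ext0_dilation//; apply: (measurableT_comp mw); exact: measurable_funM.
    + exact: ae_dilation_ext0.
    + rewrite -(OPE_well_defined_dilation l n w l0 mw); exact: wd.
  have [[r [A [p [kappa [r0 A1 p1 k0 wE]]]]]|[k [A [kappa [k0 A1 kap0 wE]]]]] :=
    OPE2_classification w omega iw wnz mdt2.
  + exists r; split=> //; left; exists A, (A + p + 1); split=> //; first lra.
    apply: (conclude r _ (kappa * (r `^ A * r `^ p))) => //.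
    * by rewrite !mulf_neq0// gt_eqF// powR_gt0.
    * by move=> x; exact: jacobi_weight_neg.
    * exact: measurable_jacobi_weight.
    * move: (ae_dilation _ _ r0 wE); apply: ae_mono => x {}wE x0.
      by rewrite wE ?mulr_gt0// dilation_beta// mulrA.
  + have l0 : 0 < - k^-1 by rewrite oppr_gt0 invr_lt0.
    exists (- k^-1); split=> //; right; exists A; split=> //.
    apply: (conclude (- k^-1) _ (kappa * (- k^-1) `^ A)) => //.
    * by rewrite mulf_neq0// gt_eqF// powR_gt0.
    * by move=> x; exact: laguerre_weight_neg.
    * exact: measurable_laguerre_weight.
    * move: (ae_dilation _ _ l0 wE); apply: ae_mono => x {}wE x0.
      rewrite wE ?mulr_gt0// -mulrA -dilation_gamma//.
      by rewrite invrN invrK opprK.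
- suff mdt (J : R -> R) n : (1 <= n)%N -> (forall n : nat, (1 <= n)%N ->
      OPE_eq n (ext0 Rpos (dilation l w)) J) ->
      (forall kappa : R, kappa != 0 ->
        (\forall x \ae lebesgue_measure, 0 < x -> w x = kappa * J (l^-1 * x)) ->
        exists omega, mult_derivative_type_wrt (@OPE_fun R n (ext0 Rpos w)) omega) ->
      OPE_mult_derivative_type n (ext0 Rpos w).
    move=> n n1; case: H => [[a [b [a1 ab eqJ]]]|[a [a1 eqJ]]]; apply: (mdt _ _ n1 eqJ).
    + move=> kappa k0 wE.
      apply: (@beta_mult_derivative_type R n w l a (b - a - 1)
        (kappa / (l `^ a * l `^ (b - a - 1)))) => //; first lra.
        by rewrite mulf_neq0// invr_neq0// mulf_neq0// gt_eqF// powR_gt0.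
      move: wE; apply: ae_mono => x wE x0.
      have y0 : 0 < l^-1 * x by rewrite mulr_gt0// invr_gt0.
      have := dilation_beta l a (b - a - 1) _ l0 y0; rewrite mulVKf ?gt_eqF// => ->.
      have -> : a + (b - a - 1) + 1 = b by ring.
      by rewrite wE// mulrA divfK// mulf_neq0// gt_eqF// powR_gt0.
    + move=> kappa k0 wE.
      apply: (@gamma_mult_derivative_type R n w (- l^-1) a (kappa / l `^ a)).
      * by rewrite oppr_eq0 invr_neq0// gt_eqF.
      * by rewrite mulf_neq0// invr_neq0// gt_eqF// powR_gt0.
      move: wE; apply: ae_mono => x wE x0.
      have y0 : 0 < l^-1 * x by rewrite mulr_gt0// invr_gt0.
      have := dilation_gamma l a _ l0 y0; rewrite mulVKf ?gt_eqF// => ->.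
      by rewrite wE// mulrA divfK// gt_eqF// powR_gt0.
  move=> n1 eqJ exO; split.
    by have [wd _ _] := eqJ n n1; apply/(OPE_well_defined_dilation l).
  have [kappa k0 wJ] := PE_eq1_proportional _ _ (eqJ 1%N isT).
  by apply: (exO kappa k0); exact: ae_undilation.
Qed.
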